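(* Let $0<\alpha<2$ and let $(\mathbb{R}^{\mathbb{Z}},\mathcal{B}^{\otimes\mathbb{Z}},Q,S)$ be the Lévy measure system of an $\alpha$-stable stationary process. Then there exist a probability space $(\Omega,\mathcal{F},\mu)$, a nonsingular automorphism $T$ of $(\Omega,\mathcal{F},\mu)$ and a function $f\in L^{\alpha}(\mu)$ such that, if $M$ denotes the map $(\omega,t)\mapsto t f(\omega)$ on $\Omega\times\mathbb{R}_{+}^{*}$ and $\widetilde{T}_{\alpha}$ denotes the map $$\widetilde{T}_{\alpha}(\omega,s):=\left(T\omega,\; s\left(\frac{\mathrm{d}T_{*}^{-1}\mu}{\mathrm{d}\mu}(\omega)\right)^{1/\alpha}\right),$$ then the map $\Theta:(\omega,t)\mapsto\{M\circ\widetilde{T}_{\alpha}^{n}(\omega,t)\}_{n\in\mathbb{Z}}$ is an isomorphism of the measure-preserving system $(\Omega\times\mathbb{R}_{+}^{*},\mathcal{F}\otimes\mathcal{B}_{+},\mu\otimes\frac{1}{s^{1+\alpha}}\,\mathrm{d}s,\widetilde{T}_{\alpha})$ with $(\mathbb{R}^{\mathbb{Z}},\mathcal{B}^{\otimes\mathbb{Z}},Q,S)$.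
   Context: All statements about measures and maps are modulo null sets; measure spaces are $\sigma$-finite Lebesgue (standard) spaces. A nonsingular automorphism $T$ of $(\Omega,\mathcal{F},\mu)$ is a bijective bi-measurable map such that the image of $\mu$ under $T$ is equivalent to $\mu$. $T_*^{-1}\mu$ is the image measure of $\mu$ under $T^{-1}$, i.e. $B\mapsto\mu(TB)$. An isomorphism of measure-preserving systems is an invertible (mod null sets) bi-measurable map that intertwines the transformations and sends one measure to the other. $\mathbb{R}_+^*=(0,\infty)$ and $\mathcal{B}_+$ is its Borel $\sigma$-algebra. An IDp process is an infinitely divisible process $X=\{X_n\}_{n\in\mathbb{Z}}$ without Gaussian part. The Lévy measure of a stationary IDp process $X$ is the shift-invariant $\sigma$-finite measure $Q$ on $\mathbb{R}^{\mathbb{Z}}$ with $Q(\{0_{\mathbb{R}^{\mathbb{Z}}}\})=0$, $\int(x_0^2\wedge 1)\,Q(\mathrm{d}\{x_n\}_{n\in\mathbb{Z}})<\infty$ and $$\mathbb{E}\Big[\exp\Big(i\sum_{k=n_1}^{n_2}a_kX_k\Big)\Big]=\exp\Big[\int_{\mathbb{R}^{\mathbb{Z}}}\Big(\exp\Big(i\sum_{k=n_1}^{n_2}a_kx_k\Big)-1-i\sum_{k=n_1}^{n_2}a_kc(x_k)\Big)Q(\mathrm{d}\{x_n\}_{n\in\mathbb{Z}})\Big]$$ for all $n_1\le n_2$ in $\mathbb{Z}$ and real $a_k$, where $c(x)=-1$ if $x<-1$, $c(x)=x$ if $-1\le x\le 1$, $c(x)=1$ if $x>1$. The Lévy measure system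 of $X$ is $(\mathbb{R}^{\mathbb{Z}},\mathcal{B}^{\otimes\mathbb{Z}},Q,S)$, where $S$ is the shift on $\mathbb{R}^{\mathbb{Z}}$. For $0<\alpha<2$, the $\alpha$-stable stationary processes are the stationary IDp processes whose Lévy measure $Q$ is nonzero and satisfies $(R_t)_*Q=t^{\alpha}Q$ for all $t>0$, where $R_t:\{x_n\}_{n\in\mathbb{Z}}\mapsto\{tx_n\}_{n\in\mathbb{Z}}$ and $(R_t)_*Q$ is the image measure, i.e. $B\mapsto Q(R_t^{-1}B)$. *)

(* Defs.v *)
From HB Require Import structures.
From mathcomp Require Import all_boot all_order all_algebra.
From mathcomp Require Import complex.
From mathcomp Require Import all_classical all_reals all_analysis.
From mathcomp Require Import measurable_realfun.

Set Implicit Arguments.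
Unset Strict Implicit.
Unset Printing Implicit Defensive.

Import Order.TTheory GRing.Theory Num.Theory.
Import numFieldNormedType.Exports.

Local Open Scope classical_set_scope.
Local Open Scope ring_scope.

(* generators of the product sigma-algebra of R^Z *)
Definition RZ_gen (R : realType) : set (set (int -> R)) :=
  \bigcup_(n in [set: int])
    preimage_set_system [set: int -> R] (fun x => x n) measurable.

Definition RZ (R : realType) := g_sigma_algebraType (@RZ_gen R).

Definition RZ_shift (R : realType) (x : RZ R) : RZ R := fun n => x (n + 1).

Definition RZ_scale (R : realType) (t : R) (x : RZ R) : RZ R :=
  fun n => t * x n.

(* ]0, +oo[ with the trace of the Borel sigma-algebra of R *)
Definition Rpos (R : realType) : Type := {posnum R}.
HB.instance Definition _ (R : realType) := Choice.on (Rpos R).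
HB.instance Definition _ (R : realType) :=
  isPointed.Build (Rpos R) (1%:pos : {posnum R}).

Definition Rpos_val (R : realType) (s : Rpos R) : R := (s : {posnum R})%:num.

Definition Rpos_gen (R : realType) : set (set (Rpos R)) :=
  preimage_set_system [set: Rpos R] (@Rpos_val R) measurable.

HB.instance Definition _ (R : realType) :=
  @isMeasurable.Build (sigma_display (@Rpos_gen R)) (Rpos R)
    <<s @Rpos_gen R >> (@sigma_algebra0 _ setT _) (@sigma_algebraC _ _)
    (@sigma_algebra_bigcup _ setT _).

(* s^(-1-alpha) ds on ]0, +oo[ *)
Definition stable_radial (R : realType) (alpha : R) (A : set (Rpos R)) : \bar R :=
  \int[lebesgue_measure]_(s in @Rpos_val R @` A) ((s `^ (1 + alpha))^-1)%:E.

Section stable_radial_measure.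
Context (R : realType).
Local Open Scope ereal_scope.

Lemma Rpos_val_gt0 (s : Rpos R) : (0 < Rpos_val s)%R.
Proof. by rewrite /Rpos_val. Qed.

Lemma Rpos_val_inj : injective (@Rpos_val R).
Proof. by move=> s t st; exact: (val_inj (st : val (s : {posnum R}) = val t)). Qed.

Lemma measurable_Rpos_val : measurable_fun [set: Rpos R] (@Rpos_val R).
Proof.
by move=> _ B mB; rewrite setTI; apply: sub_sigma_algebra; exists B; rewrite ?setTI.
Qed.

Lemma measurable_image_Rpos_val (A : set (Rpos R)) : measurable A ->
  measurable (@Rpos_val R @` A).
Proof.
move=> mA.
suff [B mB BA] : exists2 B : set R, measurable B & @Rpos_val R @^-1` B = A.
  rewrite (_ : _ @` A = B `&` `]0%R, +oo[); first exact: measurableI.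
  apply/seteqP; split => [_ [s As <-]|x [Bx]].
    split; first by move: As; rewrite -BA.
    by rewrite /= in_itv/= andbT Rpos_val_gt0.
  rewrite /= in_itv/= andbT => x0; exists (PosNum x0 : Rpos R) => //.
  by rewrite -BA.
have : <<s @Rpos_gen R >> A by [].
have : <<s @Rpos_gen R >> `<=`
    [set A | exists2 B : set R, measurable B & @Rpos_val R @^-1` B = A].
  apply: smallest_sub; last by move=> _ [B mB <-]; exists B; rewrite ?setTI.
  split; first by exists set0.
    move=> _ [B mB <-]; exists (~` B); first exact: measurableC.
    by rewrite preimage_setC setTD.
  move=> F mF; exists (\bigcup_n s2val (cid2 (mF n))).
    by apply: bigcupT_measurable => n; exact: (s2valP (cid2 (mF n))).
  rewrite preimage_bigcup; apply: eq_bigcupr => n _.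
  exact: (s2valP' (cid2 (mF n))).
by move=> /[apply].
Qed.

Variable alpha : R.
Local Notation nu := (stable_radial alpha).
Let dens : R -> \bar R := fun s => ((s `^ (1 + alpha))^-1)%:E.

Let densR : R -> R := fun s => ((s `^ (1 + alpha))^-1)%R.

Let mdensR : measurable_fun [set: R] densR.
Proof.
rewrite (_ : densR = (@powR R)^~ (- (1 + alpha)))%R.
  exact: measurable_powR.
by apply/funext => s; rewrite /densR powRN.
Qed.

Let mdens : measurable_fun [set: R] dens.
Proof. exact/measurable_EFinP. Qed.

Let dens_ge0 s : 0 <= dens s.
Proof. by rewrite lee_fin invr_ge0 powR_ge0. Qed.

Let stable_radial0 : nu set0 = 0.
Proof. by rewrite /stable_radial image_set0 integral_set0. Qed.

Let stable_radial_ge0 A : 0 <= nu A.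
Proof. by apply: integral_ge0 => s _; exact: dens_ge0. Qed.

Let stable_radial_sigma_additive : semi_sigma_additive nu.
Proof.
move=> F mF tF _; rewrite /stable_radial image_bigcup.
apply: (semi_sigma_additive_nng_induced (mu := lebesgue_measure)
  mdens dens_ge0 (F := fun n => @Rpos_val R @` F n)).
- by move=> n; exact: measurable_image_Rpos_val.
- apply/trivIsetP => i j _ _ ij; apply/seteqP; split=> // x.
  move=> [[s Fs sx] [t Ft tx]].
  have st : s = t by apply: Rpos_val_inj; rewrite sx tx.
  have := tF i j I I; rewrite -st in Ft.
  by move=> /(_ (ex_intro _ s (conj Fs Ft))) ij'; rewrite ij' eqxx in ij.
- by apply: bigcupT_measurable => n; exact: measurable_image_Rpos_val.
Qed.

HB.instance Definition _ := isMeasure.Build _ _ _ nu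
  stable_radial0 stable_radial_ge0 stable_radial_sigma_additive.

Let stable_radial_sigma_finite : sigma_finite setT nu.
Proof.
pose B n : set R := `[0%R, n%:R] `&` densR @^-1` `]-oo, n%:R].
have mB n : measurable (B n).
  apply: measurableI => //; rewrite -[X in measurable X]setTI.
  exact: mdensR.
exists (fun n => @Rpos_val R @^-1` B n).
  apply/seteqP; split => // s _.
  set m := Num.max (Rpos_val s) ((Rpos_val s `^ (1 + alpha))^-1)%R.
  have m0 : (0 <= m)%R by rewrite /m le_max ltW ?Rpos_val_gt0.
  have := archi_boundP m0; set n := Num.bound m => mn.
  exists n => //; rewrite /B/= !in_itv/= ltW ?Rpos_val_gt0//=.
  by split; apply: le_trans (ltW mn); rewrite le_max lexx ?orbT.
move=> n; have mBn : measurable (@Rpos_val R @^-1` B n).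
  by rewrite -[X in measurable X]setTI; exact: measurable_Rpos_val.
split => //; apply: (@le_lt_trans _ _ (\int[lebesgue_measure]_(s in B n) n%:R%:E)).
  apply: (@le_trans _ _ (\int[lebesgue_measure]_(s in B n) dens s)).
    apply: ge0_subset_integral => //.
    - exact: measurable_image_Rpos_val.
    - exact: mB.
    - exact: measurable_funTS.
    - by move=> s _; exact: dens_ge0.
    - by move=> ? [? ? <-].
  apply: ge0_le_integral => //.
  - exact: mB.
  - exact: measurable_funTS.
  - by move=> s [_]; rewrite /= in_itv/= lee_fin.
have -> : \int[lebesgue_measure]_(s in B n) n%:R%:E = n%:R%:E * lebesgue_measure (B n).
  exact: (@integral_cst _ _ _ lebesgue_measure (B n) (mB n) n%:R%:E).
rewrite lte_mul_pinfty ?lee_fin//.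
apply: (@le_lt_trans _ _ (lebesgue_measure (`[0%R, n%:R] : set R))).
  by rewrite le_measure ?inE//; [exact: mB|exact: subIsetl].
by rewrite lebesgue_measure_itv/=; case: ifPn => // _; rewrite -EFinD ltry.
Qed.

HB.instance Definition _ := Measure_isSigmaFinite.Build _ _ _ nu
  stable_radial_sigma_finite.

End stable_radial_measure.

Section complex_integral.
Context (R : realType).
Local Open Scope complex_scope.

Definition cexp (z : R[i]) : R[i] :=
  (expR (complex.Re z))%:C *
    (cos (complex.Im z) +i* sin (complex.Im z)).

Definition cint d (T : measurableType d) (m : {measure set T -> \bar R})
    (F : T -> R[i]) : R[i] :=
  (\int[m]_x complex.Re (F x)) +i* (\int[m]_x complex.Im (F x)).

End complex_integral.

Section levy.
Context (R : realType).
Local Open Scope complex_scope.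

Definition trunc (x : R) : R :=
  if x < -1 then -1 else if x <= 1 then x else 1.

(* sum of F k over the k in Z with n1 <= k <= n2, for n1 <= n2 *)
Definition zsum (n1 n2 : int) (F : int -> R) : R :=
  \sum_(j < `|n2 - n1|%N.+1) F (n1 + j%:Z).

Context d (Om : measurableType d) (P : probability Om R).

Definition stationary (X : {RV P >-> RZ R}) : Prop :=
  forall B : set (RZ R), measurable B ->
    distribution P X (@RZ_shift R @^-1` B) = distribution P X B.

Definition infinitely_divisible (X : {RV P >-> RZ R}) : Prop :=
  forall k : nat, (0 < k)%N ->
  exists (d' : measure_display) (Om' : measurableType d')
    (P' : probability Om' R) (Y : 'I_k -> {RV P' >-> RZ R}),
  [/\ forall A : 'I_k -> set (RZ R), (forall i, measurable (A i)) ->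
        P' (\bigcap_(i in [set: 'I_k]) (Y i @^-1` A i)) =
        (\prod_(i < k) P' (Y i @^-1` A i))%E,
      forall (i j : 'I_k) (B : set (RZ R)), measurable B ->
        distribution P' (Y i) B = distribution P' (Y j) B
    & forall B : set (RZ R), measurable B ->
        P' [set w | B (fun n => \sum_(i < k) Y i w n)] = distribution P X B].

(* The absence of a Gaussian part is expressed by Levy_char: it is the
   Levy-Khintchine formula with no quadratic term (and no drift). Here y *i is
   the purely imaginary number i y. *)
Record Levy_measure (X : {RV P >-> RZ R}) (Q : {measure set (RZ R) -> \bar R})
    : Prop := {
  Levy_sigma_finite : sigma_finite [set: RZ R] Q ;
  Levy_shift : forall B : set (RZ R), measurable B ->
    Q (@RZ_shift R @^-1` B) = Q B ;
  Levy_zero : Q [set (fun=> 0) : RZ R] = 0%E ;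
  Levy_integrable :
    (\int[Q]_x (Num.min ((x : RZ R) 0 ^+ 2) 1)%:E < +oo)%E ;
  Levy_char : forall (n1 n2 : int) (a : int -> R), n1 <= n2 ->
    cint P (fun w => cexp ((zsum n1 n2 (fun k => a k * X w k)) *i)) =
    cexp (cint Q (fun x : RZ R =>
      cexp ((zsum n1 n2 (fun k => a k * x k)) *i) - 1
      - (zsum n1 n2 (fun k => a k * trunc (x k))) *i)) }.

(* X is a stationary IDp process with Levy measure Q *)
Definition stationary_IDp (X : {RV P >-> RZ R})
    (Q : {measure set (RZ R) -> \bar R}) : Prop :=
  [/\ stationary X, infinitely_divisible X & Levy_measure X Q].

Definition stable_stationary (alpha : R) (X : {RV P >-> RZ R})
    (Q : {measure set (RZ R) -> \bar R}) : Prop :=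
  [/\ stationary_IDp X Q, Q [set: RZ R] != 0%E
    & forall t : R, 0 < t -> forall B : set (RZ R), measurable B ->
        pushforward Q (@RZ_scale R t) B = ((t `^ alpha)%:E * Q B)%E].

End levy.

Section isomorphism.
Context d1 d2 (T1 : measurableType d1) (T2 : measurableType d2) (R : realType).
Variables (m1 : {measure set T1 -> \bar R}) (m2 : {measure set T2 -> \bar R}).

Definition iso_mod0 (theta : T1 -> T2) : Prop :=
  exists (A1 : set T1) (A2 : set T2),
  [/\ measurable A1 /\ m1 (~` A1) = 0%E,
      measurable A2 /\ m2 (~` A2) = 0%E,
      set_bij A1 A2 theta,
      measurable_fun A1 theta /\
      (forall B, measurable B -> B `<=` A1 -> measurable (theta @` B))
    & forall B, measurable B -> m1 (A1 `&` theta @^-1` B) = m2 B].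

End isomorphism.

Definition measure_preserving d (T : measurableType d) (R : realType)
    (m : {measure set T -> \bar R}) (S : T -> T) : Prop :=
  measurable_fun [set: T] S /\
  forall B, measurable B -> pushforward m S B = m B.

Definition system_iso d1 d2 (T1 : measurableType d1) (T2 : measurableType d2)
    (R : realType) (m1 : {measure set T1 -> \bar R}) (S1 : T1 -> T1)
    (m2 : {measure set T2 -> \bar R}) (S2 : T2 -> T2) (theta : T1 -> T2)
    : Prop :=
  [/\ measure_preserving m1 S1, measure_preserving m2 S2, iso_mod0 m1 m2 theta
    & {ae m1, forall x, theta (S1 x) = S2 (theta x)}].

(* sigma-finite Lebesgue (standard) space: isomorphic modulo null sets to the
   real line with a sigma-finite Borel measure *)
Definition Lebesgue_space d (T : measurableType d) (R : realType)
    (m : {measure set T -> \bar R}) : Prop :=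
  sigma_finite [set: T] m /\
  exists (l : {sigma_finite_measure set (measurableTypeR R) -> \bar R})
    (phi : T -> measurableTypeR R), iso_mod0 m l phi.

Record nonsingular_automorphism d (T : measurableType d) (R : realType)
    (mu : {measure set T -> \bar R}) := NonsingularAutomorphism {
  aut : {mfun T >-> T} ;
  aut_inv : {mfun T >-> T} ;
  autK : cancel aut aut_inv ;
  aut_invK : cancel aut_inv aut ;
  aut_dominated : pushforward mu aut `<< mu ;
  aut_dominates : mu `<< pushforward mu aut }.

Definition zpow (U : Type) (g ginv : U -> U) (n : int) : U -> U :=
  match n with Posz k => iter k g | Negz k => iter k.+1 ginv end.

Section extension.
Context d (T : measurableType d) (R : realType) (mu : probability T R).
Variables (alpha : R) (S : nonsingular_automorphism mu).
Local Open Scope charge_scope.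

(* The density d(S^-1_* mu)/d mu, as a function to ]0, +oo[: it is only defined
   up to null sets and almost everywhere positive, S being nonsingular; it is
   set to 1 on the null set where the library's version is not positive, so
   that Ttilde below is a bijection. *)
Definition rn_density (w : T) : {posnum R} :=
  let r := fine (('d (charge_of_finite_measure (distribution mu (aut_inv S)))
                     '/d mu) w) in
  if pselect (0 < r) is left r0 then PosNum r0 else 1%:pos.

Definition rn_density_root (w : T) : {posnum R} :=
  PosNum (powR_gt0 (1 / alpha) [gt0 of (rn_density w)%:num]).

Definition Ttilde (z : T * Rpos R) : T * Rpos R :=
  (aut S z.1, ((z.2 : {posnum R})%:num * (rn_density_root z.1)%:num)%:pos
              : {posnum R}).

Definition Ttilde_inv (z : T * Rpos R) : T * Rpos R :=
  let w := aut_inv S z.1 in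
  (w, ((z.2 : {posnum R})%:num / (rn_density_root w)%:num)%:pos : {posnum R}).

Lemma TtildeK : cancel Ttilde Ttilde_inv.
Proof.
move=> [w s]; rewrite /Ttilde_inv /Ttilde /= autK; congr pair.
by apply: Rpos_val_inj; rewrite /Rpos_val /= mulfK.
Qed.

Lemma Ttilde_invK : cancel Ttilde_inv Ttilde.
Proof.
move=> [w s]; rewrite /Ttilde_inv /Ttilde /= aut_invK; congr pair.
by apply: Rpos_val_inj; rewrite /Rpos_val /= divfK.
Qed.

Variable f : T -> R.

Definition Mmap (z : T * Rpos R) : R := Rpos_val z.2 * f z.1.

Definition Theta (z : T * Rpos R) : RZ R :=
  fun n => Mmap (zpow Ttilde Ttilde_inv n z).

End extension.

(* Main.v *)
Require Import Defs.
From HB Require Import structures.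
From mathcomp Require Import all_boot all_order all_algebra.
From mathcomp Require Import all_classical all_reals all_analysis.
From mathcomp Require Import measurable_realfun.
From mathcomp Require Import zify lra.

Set Implicit Arguments.
Unset Strict Implicit.
Unset Printing Implicit Defensive.

Import Order.TTheory GRing.Theory Num.Theory.
Import numFieldNormedType.Exports.

Local Open Scope classical_set_scope.
Local Open Scope ring_scope.

(* Put N(x) = k sup_n 2^(-|n|/alpha) |x_n| for a suitable constant k. Scaling and
   stationarity bound Q(N > 1) by a convergent geometric series, so N is finite
   and positive Q-almost everywhere; N is homogeneous of degree one and comparable
   with its composition with the shift S. In the polar coordinates (x / N(x), N(x))
   the homogeneity of Q forces it to be mu (x) s^(-1-alpha) ds, where mu is the
   normalised trace of Q on the unit sphere {N = 1}. The shift acts on rays by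
   T w = S w / N(S w), and comparing Q(N > 1) with Q(N o S > 1) gives
   d(T^-1_* mu)/d mu (w) = N(S w)^alpha. Hence dilation (w, s) |-> s w conjugates
   Ttilde to S, and with f(w) = w_0 the map Theta is this dilation. *)

(** A single coordinate cannot serve as the radius: x_0 may vanish on a set of positive [Q]-measure,
    so all coordinates enter the supremum. The weights are dictated by homogeneity: the set where
    2^(-|n|/alpha) |x_n| > 1 has mass 2^(-|n|) Q(|x_0| > 1), and the integrability of min(x_0^2, 1)
    makes the last factor finite. The constant k makes Q(N > 1) = 1/alpha, the mass of ]1, +oo[ for
    s^(-1-alpha) ds; as the sphere {N = 1} is itself [Q]-null, mu is obtained by projecting {N > 1}
    onto it along rays. Two points about null sets shape the rest. The automorphism must be a
    bijection of all of [RZ R], so T is extended off the sphere by a map that preserves N. And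
    [Ttilde] uses a version of the Radon-Nikodym derivative that equals N(S w)^alpha only almost
    everywhere, whereas [Theta] follows whole orbits: the conjugacy is established on the
    T-invariant set of points whose entire orbit avoids the exceptional set. *)

Lemma measurable_preimage d1 d2 (T1 : measurableType d1) (T2 : measurableType d2)
    (f : T1 -> T2) (B : set T2) :
  measurable_fun [set: T1] f -> measurable B -> measurable (f @^-1` B).
Proof. by move=> mf mB; rewrite -[X in measurable X]setTI; exact: mf. Qed.

(* [pushforward] together with the measurability proof that makes it a measure,
   so that the measure structure is inferred from the term alone *)
Definition image_measure d1 d2 (T1 : measurableType d1) (T2 : measurableType d2)
    (R : realType) (m : {measure set T1 -> \bar R}) (f : T1 -> T2)
    (mf : measurable_fun [set: T1] f) : set T2 -> \bar R := pushforward m f.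

Section image_measure.
Context d1 d2 (T1 : measurableType d1) (T2 : measurableType d2) (R : realType).
Variables (m : {measure set T1 -> \bar R}) (f : T1 -> T2).
Variable mf : measurable_fun [set: T1] f.

Let image_measure0 : image_measure m mf set0 = 0%E.
Proof. by rewrite /image_measure /pushforward preimage_set0 measure0. Qed.

Let image_measure_ge0 A : (0 <= image_measure m mf A)%E.
Proof. exact: measure_ge0. Qed.

Let image_measure_sigma_additive : semi_sigma_additive (image_measure m mf).
Proof. exact: (@measure_semi_sigma_additive _ _ _ (pushforward m f)). Qed.

HB.instance Definition _ := isMeasure.Build _ _ _ (image_measure m mf)
  image_measure0 image_measure_ge0 image_measure_sigma_additive.

End image_measure.

(** * Measurability in the sequence space and in the half-line *)

Lemma measurable_RZ_coord (R : realType) (n : int) :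
  measurable_fun [set: RZ R] (fun x : RZ R => x n).
Proof.
move=> _ B mB; apply: sub_sigma_algebra; exists n => //.
by exists B.
Qed.

Lemma measurable_fun_RZ d (T : measurableType d) (R : realType)
    (D : set T) (f : T -> RZ R) :
  (forall n, measurable_fun D (fun w => f w n)) -> measurable_fun D f.
Proof.
move=> mf mD; apply: (@measurability _ _ T (RZ R) D f (@RZ_gen R) erefl) => //.
by move=> _ [_ [n _ [B mB <-]] <-]; rewrite setTI; exact: (mf n mD B mB).
Qed.

Lemma measurable_RZ_shift (R : realType) : measurable_fun [set: RZ R] (@RZ_shift R).
Proof. by apply: measurable_fun_RZ => n; exact: measurable_RZ_coord. Qed.

Lemma measurable_RZ_scale (R : realType) d (T : measurableType d)
    (a : T -> R) (f : T -> RZ R) :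
  measurable_fun [set: T] a -> measurable_fun [set: T] f ->
  measurable_fun [set: T] (fun w => RZ_scale (a w) (f w)).
Proof.
move=> ma mf; apply: measurable_fun_RZ => n; apply: measurable_funM => //.
by apply: (measurableT_comp (measurable_RZ_coord n)).
Qed.

Lemma measurable_fun_Rpos d (T : measurableType d) (R : realType)
    (f : T -> Rpos R) :
  measurable_fun [set: T] (fun w => Rpos_val (f w)) -> measurable_fun [set: T] f.
Proof.
move=> mf; apply: (@measurability _ _ T (Rpos R) setT f (@Rpos_gen R) erefl).
by move=> _ [_ [B mB <-] <-]; rewrite !setTI; exact: (measurable_preimage mf).
Qed.

(** * The radial measure s^(-1-alpha) ds: tails and uniqueness *)

Section stable_radial_theory.
Context (R : realType) (alpha : R) (alpha_gt0 : 0 < alpha).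

(** Fundamental theorem of calculus on a half-line: - s^(-alpha) / alpha is a primitive of the
    density and tends to 0 at infinity. *)
Lemma stable_radial_gt (t : R) : 0 < t ->
  stable_radial alpha [set s | t < Rpos_val s] = (t `^ (- alpha) / alpha)%:E.
Proof.
move=> t0; rewrite /stable_radial.
have -> : @Rpos_val R @` [set s | t < Rpos_val s] = `]t, +oo[%classic.
  apply/seteqP; split => [_ [s /= ts <-]|s]; rewrite /= in_itv/= andbT// => ts.
  by have s0 := lt_trans t0 ts; exists (PosNum s0 : Rpos R).
have D (x : R) : 0 < x ->
    is_derive x 1 (fun s => - (alpha^-1 * s `^ (- alpha))) ((x `^ (1 + alpha))^-1).
  move=> x0.
  have dp : is_derive x 1 (fun s : R => s `^ (- alpha)) (- alpha * x `^ (- alpha - 1)).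
    exact: is_derive1_powR.
  apply: is_derive_eq.
  rewrite /GRing.scale/= mulNr mulrN opprK mulrA mulVf ?gt_eqF// mul1r.
  by rewrite -powRN opprD addrC.
rewrite integral_itv_obnd_cbnd; last first.
  apply: measurable_funTS; apply/measurable_EFinP.
  rewrite (_ : (fun _ => _) = (@powR R)^~ (- (1 + alpha))).
    exact: measurable_powR.
  by apply/funext => s; rewrite powRN.
rewrite (@ge0_continuous_FTC2y _ _ (fun s => - (alpha^-1 * s `^ (- alpha))) _ 0).
- by rewrite sub0e -EFinN opprK mulrC.
- by move=> x _; rewrite invr_ge0 powR_ge0.
- apply: derivable_within_continuous => x; rewrite in_itv/= andbT => tx.
  have x0 : 0 < x by exact: lt_le_trans tx.
  rewrite (_ : (fun _ => _) = (@powR R)^~ (- (1 + alpha))).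
    by apply: derivable_powR; rewrite in_itv/= x0.
  by apply/funext => s; rewrite powRN.
- rewrite -[X in _ --> X]oppr0; apply: cvgN.
  rewrite -(mulr0 alpha^-1); apply: cvgMr.
  apply/cvgrPdist_lt => e e0; near=> x.
  have xe : e^-1 `^ alpha^-1 < x by near: x; exact: nbhs_pinfty_gt.
  have x0 : 0 < x by apply: le_lt_trans xe; rewrite powR_ge0.
  rewrite sub0r normrN ger0_norm ?powR_ge0// powRN -[ltRHS]invrK ltf_pV2.
  - rewrite -[ltLHS]powRr1 ?invr_ge0 ?ltW// -(mulVf (lt0r_neq0 alpha_gt0)) powRrM.
    by apply: gt0_ltr_powR => //; rewrite nnegrE ?powR_ge0// ltW.
  - by rewrite posrE powR_gt0.
  - by rewrite posrE invr_gt0.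
- by move=> x tx; apply: ex_derive; apply: D; exact: lt_trans tx.
- apply: cvg_at_right_filter.
  suff : {for t, continuous (fun s => - (alpha^-1 * s `^ (- alpha)))} by [].
  by apply: differentiable_continuous; apply/derivable1_diffP;
    apply: ex_derive; exact: D.
- move=> x; rewrite in_itv/= andbT => tx.
  by rewrite derive1E; have [_ ->] := D x (lt_trans t0 tx).
Unshelve. all: by end_near. Qed.

End stable_radial_theory.

Section radial_unique.
Context (R : realType).

Lemma Rpos_measurableE :
  measurable = <<s [set A | exists2 t : R, 0 < t &
                     A = [set s : Rpos R | t < Rpos_val s]] >>.
Proof.
set G := [set A | _]; apply/seteqP; split; last first.
  apply: smallest_sub; first exact: sigma_algebra_measurable.
  move=> _ [t t0 ->]; rewrite (_ : [set s | _] = @Rpos_val R @^-1` `]t, +oo[).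
    by apply: measurable_preimage => //; exact: measurable_Rpos_val.
  by apply/seteqP; split => s; rewrite /= in_itv/= andbT.
apply: smallest_sub; first exact: smallest_sigma_algebra.
have sG : sigma_algebra setT <<s G >> by exact: smallest_sigma_algebra.
have genE : @Rpos_gen R =
    <<s preimage_set_system setT (@Rpos_val R) (@RGenOInfty.G R) >>.
  rewrite g_sigma_preimageE; congr preimage_set_system.
  exact: RGenOInfty.measurableE.
move=> A; rewrite genE; move: A.
apply: smallest_sub => // _ [_ [t ->] <-]; rewrite setTI.
(* Half-lines starting at t <= 0 pull back to the whole space, so the generators with t > 0
   suffice. *)
have [t0|t0] := ltP 0 t.
  apply: sub_sigma_algebra; exists t => //.
  by apply/seteqP; split => s; rewrite /= in_itv/= andbT.
rewrite (_ : _ @^-1` _ = setT).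
  by case: sG => s0 sC _; have := sC _ s0; rewrite setD0.
apply/seteqP; split => // s _; rewrite /= in_itv/= andbT.
by rewrite (le_lt_trans t0)// Rpos_val_gt0.
Qed.

Context (alpha : R) (alpha_gt0 : 0 < alpha).

(** The half-lines ]t, +oo[ with t > 0 form a generating pi-system of sets of finite mass, and those
    with t = 1/(k+1) exhaust the space. Intervals reaching down to 0 would have infinite radial
    mass. *)
Lemma stable_radial_unique (m : {measure set (Rpos R) -> \bar R}) (a : R) :
  0 <= a ->
  (forall t, 0 < t ->
    m [set s | t < Rpos_val s] = (a * (t `^ (- alpha) / alpha))%:E) ->
  forall C, measurable C -> m C = (a%:E * stable_radial alpha C)%E.
Proof.
move=> a0 mE C mC.
pose m2 := mscale (NngNum a0) (stable_radial alpha).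
rewrite -[RHS]/(m2 C).
apply: (measure_unique [set A | exists2 t : R, 0 < t &
          A = [set s : Rpos R | t < Rpos_val s]]
          (fun k => [set s : Rpos R | k.+1%:R^-1 < Rpos_val s])) => //.
- exact: Rpos_measurableE.
- move=> _ _ [t t0 ->] [u u0 ->]; exists (Num.max t u).
    by rewrite lt_max t0.
  by apply/seteqP; split => s; rewrite /= gt_max => /andP.
- by move=> k; exists k.+1%:R^-1.
- apply/seteqP; split => // s _.
  have [k] := ltr_add_invr (Rpos_val_gt0 s); rewrite add0r => ks.
  by exists k.
- by move=> _ [t t0 ->]; rewrite mE//= /mscale/= stable_radial_gt.
- by move=> k; rewrite mE// ltry.
Qed.

End radial_unique.

(* The hypotheses on [Q] are bundled with the norm-like function [N] so that
   the measures built from them are determined by their arguments. *)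
Record gauge (R : realType) (alpha : R) (Q : {measure set (RZ R) -> \bar R}) :=
    Gauge {
  gauge_fun :> RZ R -> R ;
  gauge_alpha_gt0 : 0 < alpha ;
  gauge_Qshift : forall B : set (RZ R), measurable B ->
    Q (@RZ_shift R @^-1` B) = Q B ;
  gauge_Qscale : forall t : R, 0 < t -> forall B : set (RZ R), measurable B ->
    Q (@RZ_scale R t @^-1` B) = ((t `^ alpha)%:E * Q B)%E ;
  measurable_gauge : measurable_fun [set: RZ R] gauge_fun ;
  gauge_ge0 : forall x, 0 <= gauge_fun x ;
  gaugeZ : forall t x, 0 < t -> gauge_fun (RZ_scale t x) = t * gauge_fun x ;
  gauge_shift : forall x, (0 < gauge_fun (RZ_shift x)) = (0 < gauge_fun x) ;
  gauge_null : Q [set x | gauge_fun x <= 0] = 0%E ;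
  gauge_mass : Q [set x | 1 < gauge_fun x] = (alpha^-1)%:E ;
  gauge_const : R ;
  gauge_coord0 : forall x : RZ R, 0 < gauge_fun x ->
    `|x 0| <= gauge_const * gauge_fun x }.

(** * Polar coordinates for the gauge and the product form of [Q] *)

Section polar.
Context (R : realType) (alpha : R) (Q : {measure set (RZ R) -> \bar R}).
Variable N : gauge alpha Q.
Local Notation rho := (stable_radial alpha).
Local Notation shift := (@RZ_shift R).

Lemma RZ_scaleA (a b : R) (x : RZ R) : RZ_scale a (RZ_scale b x) = RZ_scale (a * b) x.
Proof. by apply/funext => n; rewrite /RZ_scale mulrA. Qed.

Lemma RZ_scale1 (x : RZ R) : RZ_scale 1 x = x.
Proof. by apply/funext => n; rewrite /RZ_scale mul1r. Qed.

Lemma RZ_shiftZ (a : R) (x : RZ R) : shift (RZ_scale a x) = RZ_scale a (shift x).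
Proof. by []. Qed.

Definition gauge_dir (x : RZ R) : RZ R := RZ_scale (N x)^-1 x.

(** The value 1 is a placeholder on the [Q]-null set where N vanishes. *)
Definition gauge_rad (x : RZ R) : Rpos R :=
  if pselect (0 < N x) is left Nx0 then PosNum Nx0 else 1%:pos.

Definition gauge_polar (x : RZ R) : RZ R * Rpos R := (gauge_dir x, gauge_rad x).

Definition dilate (z : RZ R * Rpos R) : RZ R := RZ_scale (Rpos_val z.2) z.1.

Lemma gauge_radE x : Rpos_val (gauge_rad x) = if 0 < N x then N x else 1.
Proof. by rewrite /gauge_rad; case: pselect => Nx; [rewrite Nx | case: ifP]. Qed.

Lemma gauge_dirZ t x : 0 < t -> gauge_dir (RZ_scale t x) = gauge_dir x.
Proof.
by move=> t0; rewrite /gauge_dir gaugeZ// RZ_scaleA invfM mulrAC mulVf ?mul1r ?gt_eqF.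
Qed.

Lemma gauge_gauge_dir x : 0 < N x -> N (gauge_dir x) = 1.
Proof. by move=> Nx; rewrite /gauge_dir gaugeZ ?invr_gt0// mulVf ?gt_eqF. Qed.

Lemma gauge_dir_id x : N x = 1 -> gauge_dir x = x.
Proof. by rewrite /gauge_dir => ->; rewrite invr1 RZ_scale1. Qed.

Lemma gauge_polarK x : 0 < N x -> dilate (gauge_polar x) = x.
Proof.
move=> Nx; rewrite /dilate/= gauge_radE Nx /gauge_dir RZ_scaleA mulfV ?gt_eqF//.
exact: RZ_scale1.
Qed.

Lemma gauge_dilate z : N z.1 = 1 -> N (dilate z) = Rpos_val z.2.
Proof. by move=> N1; rewrite gaugeZ ?Rpos_val_gt0// N1 mulr1. Qed.

Lemma dilateK z : N z.1 = 1 -> gauge_polar (dilate z) = z.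
Proof.
move=> N1; rewrite [RHS]surjective_pairing; congr pair.
  by rewrite gauge_dirZ ?Rpos_val_gt0// gauge_dir_id.
by apply: Rpos_val_inj; rewrite gauge_radE gauge_dilate// Rpos_val_gt0.
Qed.

Lemma measurable_gauge_dir : measurable_fun [set: RZ R] gauge_dir.
Proof.
apply: measurable_RZ_scale; last exact: measurable_id.
rewrite (_ : (fun _ => _) = @powR R ^~ (-1) \o N).
  by apply: measurableT_comp (measurable_gauge N); exact: measurable_powR.
by apply/funext => x /=; rewrite powR_inv1 ?gauge_ge0.
Qed.

Lemma measurable_gauge_gt t : measurable [set x | t < N x].
Proof.
rewrite (_ : [set x | _] = N @^-1` `]t, +oo[).
  exact: (measurable_preimage (measurable_gauge N)).
by apply/seteqP; split => x; rewrite /= in_itv/= andbT.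
Qed.

Lemma measurable_gauge_rad : measurable_fun [set: RZ R] gauge_rad.
Proof.
apply: measurable_fun_Rpos; rewrite (_ : (fun _ => _) =
    fun x => if 0 < N x then N x else 1); last exact/funext/gauge_radE.
apply: measurable_fun_ifT => //; last exact: measurable_gauge.
by apply: measurable_fun_ltr => //; exact: measurable_gauge.
Qed.

Lemma measurable_gauge_polar : measurable_fun [set: RZ R] gauge_polar.
Proof.
by apply: measurable_fun_pair; [exact: measurable_gauge_dir|
  exact: measurable_gauge_rad].
Qed.

Lemma measurable_dilate : measurable_fun [set: RZ R * Rpos R] dilate.
Proof.
apply: measurable_RZ_scale => //.
by apply: measurableT_comp => //; exact: measurable_Rpos_val.
Qed.

Definition gauge_prob_set (A : set (RZ R)) : \bar R :=
  (alpha%:E * Q (gauge_dir @^-1` A `&` [set x | (1 < N x)%R]))%E.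

Let alpha_ge0 : 0 <= alpha. Proof. exact: ltW (gauge_alpha_gt0 N). Qed.

Let gauge_prob_setE : gauge_prob_set =
  mscale (NngNum alpha_ge0)
    (image_measure (mrestr Q (measurable_gauge_gt 1)) measurable_gauge_dir).
Proof. by []. Qed.

Let gauge_prob0 : gauge_prob_set set0 = 0%E.
Proof. by rewrite /gauge_prob_set preimage_set0 set0I measure0 mule0. Qed.

Let gauge_prob_ge0 A : (0 <= gauge_prob_set A)%E.
Proof. by rewrite mule_ge0. Qed.

Let gauge_prob_sigma_additive : semi_sigma_additive gauge_prob_set.
Proof.
rewrite gauge_prob_setE; exact: measure_semi_sigma_additive.
Qed.

HB.instance Definition _ := isMeasure.Build _ _ _ gauge_prob_set
  gauge_prob0 gauge_prob_ge0 gauge_prob_sigma_additive.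

Let gauge_prob_setT : gauge_prob_set [set: RZ R] = 1%E.
Proof.
rewrite /gauge_prob_set preimage_setT setTI gauge_mass -EFinM mulfV//.
by rewrite gt_eqF// (gauge_alpha_gt0 N).
Qed.

HB.instance Definition _ := Measure_isProbability.Build _ _ _
  gauge_prob_set gauge_prob_setT.

Definition gauge_prob : probability (RZ R) R := gauge_prob_set.
Local Notation mu := gauge_prob.

Lemma gauge_prob_sphere : mu [set x | N x = 1] = 1%E.
Proof.
rewrite -gauge_prob_setT /gauge_prob_set/=; congr (_ * Q _)%E.
apply/seteqP; split => x [] //= _ Nx; split => //.
by rewrite gauge_gauge_dir// (lt_trans _ Nx).
Qed.

(** [gauge_dir] is constant along rays and {N > t} is {N > 1} dilated by t, so the homogeneity of
    [Q] contributes the factor t^(-alpha). *)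
Lemma gauge_prob_dirI (A : set (RZ R)) t : measurable A -> 0 < t ->
  Q (gauge_dir @^-1` A `&` [set x | t < N x]) =
    (mu A * (t `^ (- alpha) / alpha)%:E)%E.
Proof.
move=> mA t0; have a0 := gauge_alpha_gt0 N.
have mdA : measurable (gauge_dir @^-1` A `&` [set x | 1 < N x]).
  apply: measurableI; last exact: measurable_gauge_gt.
  exact: (measurable_preimage measurable_gauge_dir).
rewrite (_ : _ `&` _ = @RZ_scale R t^-1 @^-1`
    (gauge_dir @^-1` A `&` [set x | 1 < N x])); last first.
  apply/seteqP; split=> x; rewrite /= gauge_dirZ ?gaugeZ ?invr_gt0//.
    by rewrite ltr_pdivlMl// mulr1.
  by rewrite ltr_pdivlMl// mulr1.
rewrite (gauge_Qscale N) ?invr_gt0// -(powR_inv1 (ltW t0)) -powRrM mulN1r.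
by rewrite [RHS]muleAC -EFinM mulrCA mulfV ?mulr1 ?gt_eqF.
Qed.

Let mD : measurable [set x | 0 < N x] := measurable_gauge_gt 0.

(** A product measure is determined by rectangles. For fixed [A], the image under the radius of [Q]
    on the cone over [A] has the tails of mu(A) times the radial measure, hence equals it. *)
Lemma polar_prodE (X : set (RZ R * Rpos R)) : measurable X ->
  (mu \x rho)%E X = Q (gauge_polar @^-1` X `&` [set x | 0 < N x]).
Proof.
move=> mX; pose m' := image_measure (mrestr Q mD) measurable_gauge_polar.
rewrite -[RHS]/(m' X); apply: product_measure_unique => // A B mA mB.
have mDA : measurable (gauge_dir @^-1` A `&` [set x | 0 < N x]).
  by apply: measurableI => //; exact: (measurable_preimage measurable_gauge_dir).
pose mB' := image_measure (mrestr Q mDA) measurable_gauge_rad.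
transitivity (mB' B).
  rewrite /m' /mB' /image_measure /pushforward /mrestr/=; congr (Q _).
  by apply/seteqP; split => x /=; [move=> [[? ?] ?]|move=> [? [? ?]]].
have muA : mu A = (fine (mu A))%:E by rewrite fineK ?fin_num_measure.
transitivity ((fine (mu A))%:E * rho B)%E; last by rewrite -muA.
apply: (stable_radial_unique (gauge_alpha_gt0 N)) => //.
  exact: fine_ge0.
move=> t t0; rewrite EFinM -muA -gauge_prob_dirI//.
rewrite /mB' /image_measure /pushforward /mrestr/=; congr (Q _).
apply/seteqP; split => x /=; rewrite gauge_radE.
  by move=> [] + [? Nx]; rewrite Nx.
by move=> [? tN]; have Nx := lt_trans t0 tN; rewrite Nx.
Qed.

Lemma dilate_preimageE (B : set (RZ R)) : measurable B ->
  (mu \x rho)%E (dilate @^-1` B) = Q B.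
Proof.
move=> mB; rewrite polar_prodE; last exact: measurable_preimage measurable_dilate mB.
rewrite (_ : _ `&` _ = B `&` [set x | 0 < N x]); last first.
  by apply/seteqP; split => x [] /= + Nx; rewrite gauge_polarK.
rewrite (measureDI Q mB mD) [X in (X + _)%E](_ : _ = 0%E) ?add0e//.
apply: (@subset_measure0 _ _ _ Q _ [set x | N x <= 0]) => //.
- exact: measurableD.
- rewrite (_ : [set x | _] = ~` [set x | 0 < N x]); first exact: measurableC.
  by apply/seteqP; split => x /=; [rewrite leNgt => /negP|move/negP; rewrite -leNgt].
- by move=> x [_ /= /negP]; rewrite -leNgt.
- exact: gauge_null N.
Qed.

(** The cone over [A] has [Q]-mass mu(A) times the total radial mass, which is positive. Null sets
    of mu thus become null cones, to which the shift-invariance of [Q] applies. *)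
Lemma gauge_prob_eq0 (A : set (RZ R)) : measurable A ->
  mu A = 0%E <-> Q (gauge_dir @^-1` A `&` [set x | 0 < N x]) = 0%E.
Proof.
move=> mA.
have -> : Q (gauge_dir @^-1` A `&` [set x | 0 < N x]) = (mu A * rho setT)%E.
  rewrite -product_measure1E// polar_prodE; last exact: measurableX.
  by congr (Q _); apply/seteqP; split => x [] //= [].
split=> [->|]; first by rewrite mul0e.
move=> /eqP; rewrite mule_eq0 => /orP[/eqP//|].
rewrite gt_eqF// (@lt_le_trans _ _ (rho [set s | 1 < Rpos_val s]))//.
  rewrite (stable_radial_gt (gauge_alpha_gt0 N))// powR1 mul1r lte_fin invr_gt0.
  exact: gauge_alpha_gt0 N.
apply: le_measure; rewrite ?inE//.
rewrite (_ : [set s | _] = @Rpos_val R @^-1` `]1, +oo[).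
  by apply: measurable_preimage => //; exact: measurable_Rpos_val.
by apply/seteqP; split => s; rewrite /= in_itv/= andbT.
Qed.

End polar.

(** * The action of the shift on rays as a nonsingular automorphism *)

Section automorphism.
Context (R : realType) (alpha : R) (Q : {measure set (RZ R) -> \bar R}).
Variable N : gauge alpha Q.
Local Notation rho := (stable_radial alpha).
Local Notation shift := (@RZ_shift R).
Local Notation mu := (gauge_prob N).

Definition RZ_unshift (x : RZ R) : RZ R := fun n => x (n - 1).
Local Notation unshift := RZ_unshift.

Lemma RZ_shiftK : cancel shift unshift.
Proof. by move=> x; apply/funext => n; rewrite /RZ_unshift /RZ_shift subrK. Qed.

Lemma RZ_unshiftK : cancel unshift shift.
Proof. by move=> x; apply/funext => n; rewrite /RZ_unshift /RZ_shift addrK. Qed.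

Lemma gauge_unshift x : (0 < N (unshift x)) = (0 < N x).
Proof. by rewrite -gauge_shift RZ_unshiftK. Qed.

Lemma measurable_RZ_unshift : measurable_fun [set: RZ R] unshift.
Proof. by apply: measurable_fun_RZ => n; exact: measurable_RZ_coord. Qed.

(** The factor restores the gauge of [x] instead of normalising it to 1, which keeps the map
    invertible on the whole space; on the unit sphere it is g x / N(g x). *)
Definition renorm (g : RZ R -> RZ R) (x : RZ R) : RZ R :=
  RZ_scale (if 0 < N x then N x / N (g x) else 1) (g x).

(** Since [renorm g] preserves N, the factor applied by [renorm h] at the image point is the
    reciprocal of the one applied by [renorm g] at [x]. *)
Lemma renormK (g h : RZ R -> RZ R) : cancel g h ->
  (forall a x, h (RZ_scale a x) = RZ_scale a (h x)) ->
  (forall x, (0 < N (g x)) = (0 < N x)) -> cancel (renorm g) (renorm h).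
Proof.
move=> gK hZ Ng x; rewrite /renorm; case: (boolP (0 < N x)) => Nx.
  have Ngx : 0 < N (g x) by rewrite Ng.
  have c0 : 0 < N x / N (g x) by rewrite divr_gt0.
  set c := N x / N (g x) in c0 *; rewrite hZ gK !gaugeZ// [c * N (g x)]divfK ?gt_eqF// Nx RZ_scaleA.
  rewrite (_ : _ * _ = 1) ?RZ_scale1//.
  by rewrite invfM [N x * _]mulrCA mulfV ?mulr1 ?mulVf ?gt_eqF.
by rewrite RZ_scale1 Ng (negbTE Nx) gK RZ_scale1.
Qed.

Lemma measurable_renorm (g : RZ R -> RZ R) :
  measurable_fun [set: RZ R] g -> measurable_fun [set: RZ R] (renorm g).
Proof.
move=> mg; apply: measurable_RZ_scale => //.
have mN := measurable_gauge N.
apply: measurable_fun_ifT => //; first exact: measurable_fun_ltr.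
apply: measurable_funM => //.
rewrite (_ : (fun _ => _) = @powR R ^~ (-1) \o (N \o g)).
  by apply: measurableT_comp (measurableT_comp mN mg); exact: measurable_powR.
by apply/funext => x /=; rewrite powR_inv1 ?gauge_ge0.
Qed.

Lemma renorm_dir (g : RZ R -> RZ R) x :
  (forall a x, g (RZ_scale a x) = RZ_scale a (g x)) ->
  (forall x, (0 < N (g x)) = (0 < N x)) ->
  0 < N x -> renorm g (gauge_dir N x) = gauge_dir N (g x).
Proof.
move=> gZ Ng Nx; rewrite /renorm gauge_gauge_dir// ltr01 mul1r.
by rewrite -/(gauge_dir N _) gZ gauge_dirZ ?invr_gt0.
Qed.

Definition gauge_aut : RZ R -> RZ R := renorm shift.
Definition gauge_aut_inv : RZ R -> RZ R := renorm unshift.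

HB.instance Definition _ :=
  isMeasurableFun.Build _ _ _ _ gauge_aut (measurable_renorm (@measurable_RZ_shift R)).
HB.instance Definition _ :=
  isMeasurableFun.Build _ _ _ _ gauge_aut_inv (measurable_renorm measurable_RZ_unshift).

Lemma gauge_autK : cancel gauge_aut gauge_aut_inv.
Proof. by apply: renormK => //; [exact: RZ_shiftK|exact: gauge_shift]. Qed.

Lemma gauge_aut_invK : cancel gauge_aut_inv gauge_aut.
Proof. by apply: renormK => //; [exact: RZ_unshiftK|exact: gauge_unshift]. Qed.

(** The cone over the preimage of [A] is the shift-preimage of the cone over [A], and [Q] is
    shift-invariant. *)
Lemma gauge_prob_aut_eq0 (A : set (RZ R)) : measurable A ->
  mu (gauge_aut @^-1` A) = 0%E <-> mu A = 0%E.
Proof.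
move=> mA.
have mTA : measurable (gauge_aut @^-1` A).
  exact: (measurable_preimage (measurable_renorm (@measurable_RZ_shift R))).
apply: iff_trans (gauge_prob_eq0 N mTA) _.
apply: iff_trans _ (iff_sym (gauge_prob_eq0 N mA)).
have <- : shift @^-1` (gauge_dir N @^-1` A `&` [set x | 0 < N x]) =
    gauge_dir N @^-1` (gauge_aut @^-1` A) `&` [set x | 0 < N x].
  apply/seteqP; split => x /=; rewrite gauge_shift => -[Ax Nx]; split => //.
    by rewrite /gauge_aut renorm_dir//; exact: gauge_shift.
  by move: Ax; rewrite /gauge_aut renorm_dir//; exact: gauge_shift.
rewrite (gauge_Qshift N)//.
apply: measurableI; last exact: measurable_gauge_gt.
exact: (measurable_preimage (measurable_gauge_dir N)).
Qed.

Lemma gauge_aut_dominated : pushforward mu gauge_aut `<< mu.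
Proof.
apply/null_content_dominatesP => A mA muA; rewrite /pushforward.
exact/gauge_prob_aut_eq0.
Qed.

Lemma gauge_aut_dominates : mu `<< pushforward mu gauge_aut.
Proof.
apply/null_content_dominatesP => A mA muA.
exact/gauge_prob_aut_eq0.
Qed.

Definition gauge_automorphism : nonsingular_automorphism mu :=
  NonsingularAutomorphism gauge_autK gauge_aut_invK
    gauge_aut_dominated gauge_aut_dominates.

End automorphism.

(** * The Radon-Nikodym derivative of the automorphism *)

Section density.
Context (R : realType) (alpha : R) (Q : {measure set (RZ R) -> \bar R}).
Variable N : gauge alpha Q.
Local Notation rho := (stable_radial alpha).
Local Notation shift := (@RZ_shift R).
Local Notation mu := (gauge_prob N).
Local Notation T := (gauge_automorphism N).

Let alpha_gt0 : 0 < alpha := gauge_alpha_gt0 N.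

Let measurable_gauge_shift : measurable_fun [set: RZ R] (fun w => N (shift w)).
Proof.
exact: measurableT_comp (measurable_gauge N) (@measurable_RZ_shift R).
Qed.

Let measurable_gauge_shift_gt (A : set (RZ R)) : measurable A ->
  measurable [set z : RZ R * Rpos R |
    A z.1 /\ 1 < Rpos_val z.2 * N (shift z.1)].
Proof.
move=> mA; rewrite (_ : [set z | _] = fst @^-1` A `&`
    (fun z : RZ R * Rpos R => 1 < Rpos_val z.2 * N (shift z.1)) @^-1` [set true]).
  apply: measurableI; first exact: (measurable_preimage measurable_fst).
  apply: measurable_preimage => //; apply: measurable_fun_ltr => //.
  apply: measurable_funM.
    exact: (measurableT_comp (@measurable_Rpos_val R)).
  exact: (measurableT_comp measurable_gauge_shift).
by apply/seteqP; split => z /= [].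
Qed.

(** With x = s w, the set on the right describes the x with N(S x) > 1 and direction in [A]. It is
    the shift-preimage of the set that defines the left-hand side, so both have the same
    [Q]-mass. *)
Lemma gauge_aut_inv_dirE (A : set (RZ R)) : measurable A ->
  mu (gauge_aut_inv N @^-1` A) =
  (alpha%:E * (mu \x rho)%E
     [set z | A z.1 /\ (1 < Rpos_val z.2 * N (shift z.1))%R])%E.
Proof.
move=> mA; set X := [set z | _].
have mX : measurable X by exact: measurable_gauge_shift_gt.
rewrite (polar_prodE N mX) /gauge_prob/= /gauge_prob_set; congr (_ * _)%E.
have -> : gauge_polar N @^-1` X `&` [set x | 0 < N x] =
    shift @^-1` (gauge_dir N @^-1` (gauge_aut_inv N @^-1` A) `&` [set x | 1 < N x]).
  have inv_dir x : 0 < N x ->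
      gauge_aut_inv N (gauge_dir N (shift x)) = gauge_dir N x.
    move=> Nx; rewrite -[RHS](gauge_autK N).
    by congr (gauge_aut_inv N _); rewrite /gauge_aut renorm_dir//; exact: gauge_shift.
  have radN x : 0 < N x -> N x * N (shift (gauge_dir N x)) = N (shift x).
    move=> Nx; rewrite /gauge_dir RZ_shiftZ gaugeZ ?invr_gt0//.
    by rewrite mulrA mulfV ?mul1r ?gt_eqF.
  apply/seteqP; split => x; rewrite /X /gauge_polar/= gauge_radE.
    move=> [[Ax + Nx]]; rewrite Nx radN// => Nsx; split => //.
    by rewrite inv_dir.
  move=> [Ax Nsx]; have Nx : 0 < N x by rewrite -gauge_shift (lt_trans _ Nsx).
  by rewrite Nx radN//; move: Ax; rewrite inv_dir.
rewrite (gauge_Qshift N)//.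
apply: measurableI; last exact: measurable_gauge_gt.
have miA : measurable (gauge_aut_inv N @^-1` A).
  exact: (measurable_preimage (measurable_renorm N (@measurable_RZ_unshift R))).
exact: measurable_preimage (measurable_gauge_dir N) miA.
Qed.

Definition gauge_density (w : RZ R) : R := N (shift w) `^ alpha.

Lemma measurable_gauge_density : measurable_fun [set: RZ R] gauge_density.
Proof.
exact: (measurableT_comp (@measurable_powR R alpha) measurable_gauge_shift).
Qed.

(** Over w in [A] the section is ]1/N(S w), +oo[, of radial mass N(S w)^alpha / alpha, and the
    factor alpha cancels. If N(S w) = 0, the section is empty and the density is 0 as well. *)
Lemma distribution_gauge_aut_inv (A : set (RZ R)) : measurable A ->
  distribution mu (aut_inv T) A = (\int[mu]_(w in A) (gauge_density w)%:E)%E.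
Proof.
move=> mA; rewrite [LHS](gauge_aut_inv_dirE mA) /product_measure1.
rewrite [RHS]integral_mkcond -ge0_integralZl_EFin//; last exact: ltW.
  apply: eq_integral => w _ /=; rewrite patchE; case: ifPn => wA.
    have [Nw|Nw] := ltP 0 (N (shift w)).
      rewrite (_ : xsection _ _ = [set s | (N (shift w))^-1 < Rpos_val s]).
        rewrite stable_radial_gt// ?invr_gt0// -EFinM mulrCA mulfV ?gt_eqF// mulr1.
        by rewrite -(powR_inv1 (ltW Nw)) -powRrM mulN1r opprK.
      apply/seteqP; split => s; rewrite /xsection/= !inE/= -ltr_pdivrMr// div1r.
        by case.
      by move=> ?; split => //; rewrite inE in wA.
    have Nw0 : N (shift w) = 0 by apply/eqP; rewrite eq_le Nw gauge_ge0.
    rewrite (_ : xsection _ _ = set0).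
      by rewrite measure0 mule0 /gauge_density Nw0 powR0 ?gt_eqF.
    by apply/seteqP; split => s //; rewrite /xsection/= inE/= Nw0 mulr0 ltr10 => -[].
  rewrite (_ : xsection _ _ = set0) ?measure0 ?mule0//.
  apply/seteqP; split => s //; rewrite /xsection/= inE/= => -[Aw _].
  by move: wA; rewrite notin_setE.
apply: (@measurable_fun_xsection _ _ _ _ _ rho).
exact: measurable_gauge_shift_gt.
Qed.

Lemma ae_gauge1 : {ae mu, forall w, N w = 1}.
Proof.
have mS : measurable [set w | N w = 1].
  exact: (measurable_preimage (measurable_gauge N) (measurable_set1 1)).
exists (~` [set w | N w = 1]); split => //; first exact: measurableC.
by rewrite probability_setC// gauge_prob_sphere subee.
Qed.

Local Notation nu := (charge_of_finite_measure (distribution mu (aut_inv T))).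

Let gauge_aut_inv_dominated : nu `<< mu.
Proof.
apply/null_content_dominatesP => A mA muA.
have mB : measurable (gauge_aut_inv N @^-1` A).
  exact: (measurable_preimage (measurable_renorm N (@measurable_RZ_unshift R))).
apply: (gauge_prob_aut_eq0 N mB).1; rewrite -[RHS]muA; congr (mu _).
by apply/seteqP; split => x /=; rewrite gauge_autK.
Qed.

(** Both densities have the same integral over every measurable set. On the sphere N(S w) > 0, so
    the default value 1 in [rn_density] does not interfere. *)
Lemma rn_density_gaugeE :
  {ae mu, forall w, (rn_density T w)%:num = gauge_density w}.
Proof.
have : ae_eq mu setT (Radon_Nikodym nu mu) (EFin \o gauge_density).
  apply: integral_ae_eq => //.
  - exact: Radon_Nikodym_integrable.
  - by apply/measurable_EFinP; exact: measurable_gauge_density.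
  - move=> A _ mA; rewrite -Radon_Nikodym_integral//.
    exact: distribution_gauge_aut_inv.
apply: filterS2 ae_gauge1 => w Nw /(_ I) RNw.
rewrite /rn_density; move: RNw => /= ->.
case: pselect => //= /negP; rewrite -leNgt /gauge_density.
have Nsw : 0 < N (shift w) by rewrite gauge_shift Nw.
by rewrite leNgt powR_gt0.
Qed.

Lemma measurable_rn_density :
  measurable_fun [set: RZ R] (fun w => (rn_density T w)%:num).
Proof.
pose r w := fine (Radon_Nikodym nu mu w).
rewrite (_ : (fun _ => _) = fun w => if 0 < r w then r w else 1); last first.
  apply/funext => w; rewrite /rn_density -/(r w).
  by case: pselect => [r0|]; [rewrite /= r0|case: ifP].
have mr : measurable_fun [set: RZ R] r.
  have mRN : measurable_fun [set: RZ R] (Radon_Nikodym nu mu).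
    exact: measurable_int (Radon_Nikodym_integrable gauge_aut_inv_dominated).
  exact: (measurableT_comp (fine_measurable measurableT) mRN).
by apply: measurable_fun_ifT => //; exact: measurable_fun_ltr.
Qed.

End density.

(** * Orbits of [Ttilde] and the identification of [Theta] with the dilation *)

Lemma zpowS (U : Type) (g ginv : U -> U) (n : int) (z : U) :
  cancel g ginv -> zpow g ginv (n + 1) z = zpow g ginv n (g z).
Proof.
move=> gK; case: n => [k|[|k]].
- by rewrite -PoszD addn1 [LHS]iterSr.
- by rewrite /= gK.
- have -> : Negz k.+1 + 1 = Negz k by rewrite !NegzE -[k.+2]addn1 PoszD opprD subrK.
  by rewrite /zpow [RHS]iterSr gK.
Qed.

(** Matches the form of [Theta], which reads a zeroth coordinate along an orbit: once the conjugacy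
    is known, these readings recover the dilated point. *)
Lemma zpow_shiftE (R : realType) (n : int) (x : RZ R) :
  zpow (@RZ_shift R) (@RZ_unshift R) n x 0 = x n.
Proof.
have posE k m (y : RZ R) : iter k (@RZ_shift R) y m = y (m + k%:Z).
  elim: k m => [|k IHk] m; first by rewrite addr0.
  by rewrite iterS [LHS]IHk -addrA -PoszD add1n.
have negE k m (y : RZ R) : iter k (@RZ_unshift R) y m = y (m - k%:Z).
  elim: k m => [|k IHk] m; first by rewrite subr0.
  by rewrite iterS [LHS]IHk -addrA -opprD -PoszD add1n.
by case: n => k; rewrite /zpow ?posE ?negE add0r ?NegzE.
Qed.

Lemma ae_comp_null d (T : measurableType d) (R : realType)
    (m : {measure set T -> \bar R}) (f : T -> T) (P : T -> Prop) :
  measurable_fun [set: T] f ->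
  (forall A, measurable A -> m A = 0%E -> m (f @^-1` A) = 0%E) ->
  {ae m, forall x, P x} -> {ae m, forall x, P (f x)}.
Proof.
move=> mf f0 [A [mA A0 PA]]; exists (f @^-1` A); split; last by move=> x /PA.
- exact: measurable_preimage mf mA.
- exact: f0.
Qed.

Section isomorphism.
Context (R : realType) (alpha : R) (Q : {measure set (RZ R) -> \bar R}).
Variable N : gauge alpha Q.
Local Notation rho := (stable_radial alpha).
Local Notation shift := (@RZ_shift R).
Local Notation mu := (gauge_prob N).
Local Notation T := (gauge_automorphism N).
Local Notation Tt := (Ttilde alpha T).
Local Notation Tt_inv := (Ttilde_inv alpha T).
Local Notation Th := (Theta alpha T (fun w : RZ R => w 0)).

Let alpha_gt0 : 0 < alpha := gauge_alpha_gt0 N.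

Definition gauge_reg (w : RZ R) : Prop :=
  N w = 1 /\ (rn_density T w)%:num = gauge_density N w.

(** The radial factor (N(S w)^alpha)^(1/alpha) cancels the division by N(S w) in the action on
    rays. *)
Lemma dilate_Ttilde z : gauge_reg z.1 -> dilate (Tt z) = shift (dilate z).
Proof.
move=> [Nw rnE].
have Nsw : 0 < N (shift z.1) by rewrite gauge_shift Nw.
rewrite /dilate /Ttilde /Rpos_val/= rnE /gauge_density -powRrM div1r.
rewrite mulfV ?gt_eqF// powRr1 ?ltW// /gauge_aut /renorm Nw ltr01 RZ_scaleA.
by rewrite -mulrA div1r mulfV ?gt_eqF// mulr1.
Qed.

Lemma dilate_Ttilde_inv z : gauge_reg (Tt_inv z).1 ->
  dilate (Tt_inv z) = RZ_unshift (dilate z).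
Proof. by move=> /dilate_Ttilde; rewrite Ttilde_invK => ->; rewrite RZ_shiftK. Qed.

Definition gauge_good : set (RZ R) :=
  [set w | forall n : int, gauge_reg (zpow (gauge_aut N) (gauge_aut_inv N) n w)].

Lemma zpow_Ttilde_fst n z :
  (zpow Tt Tt_inv n z).1 = zpow (gauge_aut N) (gauge_aut_inv N) n z.1.
Proof.
have posE k : (iter k Tt z).1 = iter k (gauge_aut N) z.1.
  by elim: k => // k IHk; rewrite !iterS /= IHk.
have negE k : (iter k Tt_inv z).1 = iter k (gauge_aut_inv N) z.1.
  by elim: k => // k IHk; rewrite !iterS /= IHk.
by case: n => k; rewrite /zpow ?posE ?negE.
Qed.

Lemma dilate_zpow n z : gauge_good z.1 ->
  dilate (zpow Tt Tt_inv n z) = zpow shift (@RZ_unshift R) n (dilate z).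
Proof.
move=> gz.
have reg m : gauge_reg (zpow Tt Tt_inv m z).1 by rewrite zpow_Ttilde_fst.
have posE k : dilate (iter k Tt z) = iter k shift (dilate z).
  elim: k => // k IHk; rewrite !iterS dilate_Ttilde ?IHk//.
  exact: (reg (Posz k)).
have negE k : dilate (iter k Tt_inv z) = iter k (@RZ_unshift R) (dilate z).
  elim: k => // k IHk; rewrite !iterS dilate_Ttilde_inv ?IHk//.
  (* A backward step from the k-th inverse iterate needs regularity at its endpoint, the inverse
     iterate of order k+1, which [Negz k] encodes. *)
  exact: (reg (Negz k)).
by case: n => k; rewrite /zpow ?posE ?negE.
Qed.

Lemma Theta_dilate z : gauge_good z.1 -> Th z = dilate z.
Proof.
move=> gz; apply/funext => n; rewrite -[RHS]zpow_shiftE -dilate_zpow//.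
Qed.

Lemma Theta_Ttilde z : Th (Tt z) = shift (Th z).
Proof.
apply/funext => n; rewrite /Theta /RZ_shift zpowS//; exact: TtildeK.
Qed.

Lemma gauge_good_aut w : gauge_good (gauge_aut N w) <-> gauge_good w.
Proof.
have K := gauge_autK N; split => gw n.
  by rewrite -(subrK 1 n) zpowS.
by rewrite -zpowS.
Qed.

Lemma measurable_gauge_aut : measurable_fun [set: RZ R] (gauge_aut N).
Proof. exact: measurable_renorm (@measurable_RZ_shift R). Qed.

Lemma measurable_gauge_aut_inv : measurable_fun [set: RZ R] (gauge_aut_inv N).
Proof. exact: measurable_renorm (@measurable_RZ_unshift R). Qed.

Lemma measurable_iter d (U : measurableType d) (f : U -> U) k :
  measurable_fun [set: U] f -> measurable_fun [set: U] (iter k f).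
Proof.
by move=> mf; elim: k => [|k IHk]; [exact: measurable_id|exact: measurableT_comp].
Qed.

Lemma gauge_goodE : gauge_good =
  (\bigcap_k (iter k (gauge_aut N) @^-1` gauge_reg)) `&`
  (\bigcap_k (iter k.+1 (gauge_aut_inv N) @^-1` gauge_reg)).
Proof.
apply/seteqP; split => [w gw|w [gp gn] [k|k]]; last 2 first.
- exact: gp.
- exact: gn.
by split=> k _; [exact: (gw (Posz k))|exact: (gw (Negz k))].
Qed.

Lemma measurable_gauge_good : measurable gauge_good.
Proof.
have mreg : measurable (gauge_reg : set (RZ R)).
  rewrite (_ : gauge_reg = N @^-1` [set 1] `&`
      (fun w => (rn_density T w)%:num == gauge_density N w) @^-1` [set true]).
    apply: measurableI; first exact: (measurable_preimage (measurable_gauge N)).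
    apply: measurable_preimage => //; apply: measurable_fun_eqr.
      exact: measurable_rn_density.
    exact: measurable_gauge_density.
  by apply/seteqP; split => w [? /eqP].
rewrite gauge_goodE; apply: measurableI; apply: bigcapT_measurable => k;
  apply: measurable_preimage => //; apply: measurable_iter.
- exact: measurable_gauge_aut.
- exact: measurable_gauge_aut_inv.
Qed.

(** Preimages of null sets under T and its inverse are null, so regularity holds almost everywhere
    at each of the countably many iterates. *)
Lemma gauge_prob_good : mu (~` gauge_good) = 0%E.
Proof.
have aereg : {ae mu, forall w, gauge_reg w}.
  by apply: filterS2 (ae_gauge1 N) (rn_density_gaugeE N).
have aeiter (f : RZ R -> RZ R) k : measurable_fun [set: RZ R] f ->
    (forall A, measurable A -> mu A = 0%E -> mu (f @^-1` A) = 0%E) ->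
    {ae mu, forall w, gauge_reg (iter k f w)}.
  move=> mf f0; elim: k => // k IHk.
  by apply: filterS (ae_comp_null mf f0 IHk) => w; rewrite iterSr.
apply/negligibleP; first exact: measurableC measurable_gauge_good.
suff : {ae mu, forall w, gauge_good w} by [].
have /ae_foralln aepos : forall k, {ae mu, forall w, gauge_reg (iter k (gauge_aut N) w)}.
  move=> k; apply: aeiter; first exact: measurable_gauge_aut.
  by move=> A mA; exact: (gauge_prob_aut_eq0 N mA).2.
have /ae_foralln aeneg : forall k,
    {ae mu, forall w, gauge_reg (iter k.+1 (gauge_aut_inv N) w)}.
  move=> k; apply: aeiter; first exact: measurable_gauge_aut_inv.
  move=> A mA muA.
  have mB := measurable_preimage measurable_gauge_aut_inv mA.
  (* The preimage of [A] under the inverse map is null because pulling it back by the map itself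
     gives [A]. *)
  apply: (gauge_prob_aut_eq0 N mB).1; rewrite -[RHS]muA; congr (mu _).
  by apply/seteqP; split => x /=; rewrite gauge_autK.
apply: filterS2 aepos aeneg => w gp gn; rewrite gauge_goodE.
by split => k _; [exact: gp|exact: gn].
Qed.

End isomorphism.

(** * The isomorphism of systems and the integrability of the zeroth coordinate *)

Section system_isomorphism.
Context (R : realType) (alpha : R) (Q : {measure set (RZ R) -> \bar R}).
Variable N : gauge alpha Q.
Local Notation rho := (stable_radial alpha).
Local Notation shift := (@RZ_shift R).
Local Notation mu := (gauge_prob N).
Local Notation T := (gauge_automorphism N).
Local Notation Tt := (Ttilde alpha T).
Local Notation Th := (Theta alpha T (fun w : RZ R => w 0)).
Local Notation good := (gauge_good N).

Let m : {measure set (RZ R * Rpos R) -> \bar R} := (mu \x rho)%E.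

Lemma measurable_Ttilde : measurable_fun [set: RZ R * Rpos R] Tt.
Proof.
apply: measurable_fun_pair.
  exact: (measurableT_comp (measurable_gauge_aut N)).
apply: measurable_fun_Rpos.
apply: measurable_funM; first exact: (measurableT_comp (@measurable_Rpos_val R)).
apply: (measurableT_comp (f := fun w => (rn_density_root alpha T w)%:num)) => //.
exact: (measurableT_comp (@measurable_powR R (1 / alpha)) (measurable_rn_density N)).
Qed.

Let mgood : measurable good := measurable_gauge_good N.

Let A1 : set (RZ R * Rpos R) := good `*` setT.
Let A2 : set (RZ R) := gauge_dir N @^-1` good `&` [set x | 0 < N x].

Let mA1 : measurable A1. Proof. exact: measurableX. Qed.

Let mA2 : measurable A2.
Proof.
apply: measurableI; last exact: measurable_gauge_gt.
exact: (measurable_preimage (measurable_gauge_dir N)).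
Qed.

Let A1_null : m (~` A1) = 0%E.
Proof.
rewrite (_ : ~` A1 = (~` good) `*` setT).
  rewrite [LHS]product_measure1E//; last exact: measurableC.
  by rewrite [X in (X * _)%E](gauge_prob_good N) mul0e.
apply/seteqP; split => z; last by move=> [nz _] [/nz].
by move=> nz; split => // gz; apply: nz.
Qed.

Let gauge1 w : good w -> N w = 1. Proof. by move=> /(_ 0) []. Qed.

(** [Q] is the image of the product measure under dilation, and dilation maps [A1] into [A2], the
    cone over the good directions. *)
Let A2_null : Q (~` A2) = 0%E.
Proof.
have mCA2 := measurableC mA2.
rewrite -(dilate_preimageE N mCA2) -[LHS]/(m _).
have mdA := measurable_preimage (@measurable_dilate R) mCA2.
apply: (subset_measure0 mdA (measurableC mA1) _ A1_null).
move=> z /= nA2 [gz _]; apply: nA2; split.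
  by rewrite /= gauge_dirZ ?Rpos_val_gt0// gauge_dir_id// gauge1.
by rewrite /= gauge_dilate ?Rpos_val_gt0// gauge1.
Qed.

Let measureA1I (B : set (RZ R * Rpos R)) : measurable B ->
  m (A1 `&` B) = m B.
Proof.
move=> mB; rewrite [RHS](measureDI m mB mA1) setIC.
rewrite -[LHS]add0e; congr (_ + _)%E; apply/esym.
by apply: (subset_measure0 (measurableD mB mA1) (measurableC mA1) _ A1_null) => z [].
Qed.

Let ThE z : A1 z -> Th z = dilate z.
Proof. by move=> [gz _]; exact: Theta_dilate. Qed.

Let polarK z : A1 z -> gauge_polar N (Th z) = z.
Proof. by move=> Az; rewrite ThE// dilateK// gauge1//; case: Az. Qed.

Let Theta_measure (B : set (RZ R)) : measurable B ->
  m (A1 `&` Th @^-1` B) = Q B.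
Proof.
move=> mB.
have -> : A1 `&` Th @^-1` B = A1 `&` @dilate R @^-1` B.
  by apply/seteqP; split => z [Az]; rewrite /= ThE.
have mdB := measurable_preimage (@measurable_dilate R) mB.
by rewrite measureA1I//; exact: dilate_preimageE.
Qed.

(** On [A2] the map [gauge_polar] is a measurable inverse of [Theta], so images under [Theta] are
    traces of preimages under [gauge_polar]. *)
Lemma Theta_iso_mod0 : iso_mod0 m Q Th.
Proof.
have A12 z : A1 z -> A2 (Th z).
  move=> Az; have [gz _] := Az; rewrite ThE//; split.
    by rewrite /= gauge_dirZ ?Rpos_val_gt0// gauge_dir_id// gauge1.
  by rewrite /= gauge_dilate ?Rpos_val_gt0// gauge1.
have A21 x : A2 x -> A1 (gauge_polar N x) /\ Th (gauge_polar N x) = x.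
  move=> [gx Nx]; split => //.
  by rewrite ThE// gauge_polarK.
have imE B : B `<=` A1 -> Th @` B = A2 `&` gauge_polar N @^-1` B.
  move=> BA1; apply/seteqP; split => [_ [z Bz <-]|x [/A21[Ax Thx] Bx]].
    by split; [exact: A12 (BA1 z Bz)|rewrite /= polarK//; exact: BA1].
  by exists (gauge_polar N x).
exists A1, A2; split.
- by split.
- by split.
- split.
  + by move=> z /A12.
  + by move=> z t /[!inE] Az At /(congr1 (gauge_polar N)); rewrite !polarK.
  + by move=> x /A21[Ax Thx]; exists (gauge_polar N x).
- split.
    apply: (eq_measurable_fun (@dilate R)).
      by move=> z /[!inE] Az; rewrite ThE.
    exact: measurable_funTS (@measurable_dilate R).
  move=> B mB BA1; rewrite imE//; apply: measurableI => //.
  exact: (measurable_preimage (measurable_gauge_polar N)).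
- exact: Theta_measure.
Qed.

(** Obtained by transport: on the invariant set [A1], [Theta] carries the product measure to [Q] and
    [Ttilde] to the shift, which preserves [Q]. *)
Lemma Ttilde_measure_preserving : measure_preserving m Tt.
Proof.
split; first exact: measurable_Ttilde.
move=> B mB; rewrite /pushforward.
have A1Tt z : A1 (Tt z) <-> A1 z.
  by split => -[gz _]; split => //; apply/gauge_good_aut.
have mTB := measurable_preimage measurable_Ttilde mB.
have mpB := measurable_preimage (measurable_gauge_polar N) mB.
have mspB := measurable_preimage (@measurable_RZ_shift R) mpB.
have e1 := measureA1I mTB; have e2 := measureA1I mB.
rewrite -e2 -e1.
have -> : A1 `&` Tt @^-1` B = A1 `&` Th @^-1` (shift @^-1` (gauge_polar N @^-1` B)).
  have polarTt z : A1 z -> gauge_polar N (shift (Th z)) = Tt z.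
    by move=> Az; rewrite -Theta_Ttilde polarK; [|exact: (A1Tt z).2].
  apply/seteqP; split => z [Az Bz]; split; [exact: Az| |exact: Az|].
    by rewrite /preimage/= polarTt.
  by move: Bz; rewrite /preimage/= polarTt.
have -> : A1 `&` B = A1 `&` Th @^-1` (gauge_polar N @^-1` B).
  apply/seteqP; split => z [Az Bz]; split; [exact: Az| |exact: Az|].
    by rewrite /preimage/= polarK.
  by move: Bz; rewrite /preimage/= polarK.
have e3 := Theta_measure mpB; have e4 := Theta_measure mspB.
by rewrite e3 e4; exact: gauge_Qshift N _ mpB.
Qed.

Lemma Theta_system_iso : system_iso (mu \x rho)%E Tt Q shift Th.
Proof.
split.
- exact: Ttilde_measure_preserving.
- split; first exact: measurable_RZ_shift.
  by move=> B mB; exact: gauge_Qshift N B mB.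
- exact: Theta_iso_mod0.
- by apply: aeW => z; exact: Theta_Ttilde.
Qed.

(** On the sphere the coordinate is bounded by the gauge constant, and mu is a probability. *)
Lemma coord0_Lfun : (fun w : RZ R => w 0) \in Lfun mu alpha%:E.
Proof.
have a0 := gauge_alpha_gt0 N; pose C := `|gauge_const N|.
have mc := @measurable_RZ_coord R 0.
apply/andP; split; rewrite inE/=; first exact: mc.
rewrite /finite_norm unlock poweR_lty//.
apply: (@le_lt_trans _ _ (\int[mu]_w (cst (C `^ alpha)%:E w))%E); last first.
  by rewrite integral_cst// [X in (_ * X)%E]probability_setT mule1 ltry.
apply: ae_ge0_le_integral => //.
- by move=> w _; exact: poweR_ge0.
- apply: (measurableT_comp (measurable_poweR alpha)).
  by apply: measurableT_comp => //; exact/measurable_EFinP.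
- by move=> w _; rewrite lee_fin powR_ge0.
- apply: filterS (ae_gauge1 N) => w Nw _.
  rewrite -[leLHS]/(`|w 0| `^ alpha)%:E lee_fin.
  apply: ge0_ler_powR; rewrite ?nnegrE /C ?(ltW a0)//.
  have Nw0 : 0 < N w by rewrite Nw.
  apply: le_trans (gauge_coord0 Nw0) _; rewrite Nw mulr1.
  exact: ler_norm.
Qed.

End system_isomorphism.

(** * Standardness of [RZ R]: a measurable coding into the real line *)

(* Base-4 expansions with digits 0 and 1: since the tail of such an expansion is
   at most 1/8, the leading digit is 1 iff the value is at least 1/4. *)
Section digits.
Context (R : realType).

Definition digit_term (b : nat -> bool) (k : nat) : R :=
  if b k then (4 ^+ k.+1)^-1 else 0.

Definition digit_value (b : nat -> bool) : R :=
  fine (\sum_(k <oo) (digit_term b k)%:E)%E.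

Fixpoint digit_residue (k : nat) (y : R) : R :=
  if k is k'.+1 then 4 * digit_residue k' y - (if 4^-1 <= digit_residue k' y then 1 else 0)
  else y.

Lemma digit_term_ge0 b k : (0 <= (digit_term b k)%:E)%E.
Proof. by rewrite lee_fin /digit_term; case: ifP; rewrite // invr_ge0 exprn_ge0. Qed.

Lemma digit_series_le b : (\sum_(k <oo) (digit_term b k)%:E <= (2^-1)%:E)%E.
Proof.
(* The bound 1/2 comes from comparing 4^(-(k+1)) with (1/2) 2^(-(k+1)); any bound below 1 would
   separate the leading digits. *)
apply: le_trans (epsilon_trick0 xpredT (_ : 0 <= (2^-1 : R))); last by rewrite invr_ge0.
apply: lee_nneseries => [k _ _|k _]; first exact: digit_term_ge0.
rewrite lee_fin /digit_term.
apply: (@le_trans _ _ (4 ^+ k.+1)^-1).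
  by case: ifP; rewrite // invr_ge0 exprn_ge0.
rewrite natrX -invfM -exprS lef_pV2 ?posrE ?exprn_gt0//.
rewrite (_ : 4 = 2 ^+ 2); last by rewrite expr2 -natrM.
by rewrite -exprM ler_eXn2l ?ltr1n// mul2n -addnn addSnnS leq_addl.
Qed.

Lemma digit_series_fin b : ((\sum_(k <oo) (digit_term b k)%:E)%E \is a fin_num).
Proof.
rewrite ge0_fin_numE; last by apply: nneseries_ge0 => k _ _; exact: digit_term_ge0.
by apply: le_lt_trans (digit_series_le b) _; rewrite ltry.
Qed.

Lemma digit_value_ge0 b : 0 <= digit_value b.
Proof.
by apply/fine_ge0/nneseries_ge0 => k _ _; exact: digit_term_ge0.
Qed.

Lemma digit_value_le b : digit_value b <= 2^-1.
Proof. by rewrite -lee_fin fineK ?digit_series_fin// digit_series_le. Qed.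

Lemma digit_value_recl b :
  digit_value b = ((if b 0%N then 1 else 0) + digit_value (b \o succn)) / 4.
Proof.
apply: EFin_inj; rewrite fineK ?digit_series_fin// mulrDl EFinD EFinM.
rewrite mulrC EFinM fineK ?digit_series_fin//.
rewrite nneseries_recl//; last by move=> k _; exact: digit_term_ge0.
congr (_ + _)%E.
  by rewrite -EFinM /digit_term expr1; case: ifP; rewrite ?mul1r ?mul0r.
rewrite -(nneseries_addn 1); last by move=> k; exact: digit_term_ge0.
rewrite -nneseriesZl; last by move=> k _; exact: digit_term_ge0.
apply: eq_eseriesr => k _; rewrite -EFinM /digit_term addn1 /=.
by case: ifP; rewrite ?mulr0// exprS invfM.
Qed.

Lemma digit_value_head b : (4^-1 <= digit_value b) = b 0%N.
Proof.
rewrite digit_value_recl ler_pdivlMr// mulVf//.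
case: (b 0%N) => /=; first by rewrite lerDl digit_value_ge0.
rewrite add0r leNgt (le_lt_trans (digit_value_le _))//.
by rewrite invf_lt1// ltr1n.
Qed.

Lemma digit_residue_value k b :
  digit_residue k (digit_value b) = digit_value (fun j => b (k + j)%N).
Proof.
elim: k => [|k IHk]; first by [].
rewrite /= IHk digit_value_head addn0 [in LHS]digit_value_recl addn0.
rewrite mulrC divfK// addrC addKr; congr digit_value.
by apply/funext => j; rewrite /= addSnnS.
Qed.

Lemma digit_value_nth k b : (4^-1 <= digit_residue k (digit_value b)) = b k.
Proof. by rewrite digit_residue_value digit_value_head addn0. Qed.

Lemma measurable_digit_residue k : measurable_fun [set: R] (digit_residue k).
Proof.
elim: k => [|k IHk]; first exact: measurable_id.
apply: measurable_funB; first exact: measurable_funM.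
by apply: measurable_fun_ifT => //; exact: measurable_fun_ler.
Qed.

Lemma measurable_digit_value d (T : measurableType d) (b : nat -> T -> bool) :
  (forall k, measurable_fun [set: T] (b k)) ->
  measurable_fun [set: T] (fun x => digit_value (fun k => b k x)).
Proof.
move=> mb; apply: (measurableT_comp (fine_measurable measurableT)).
rewrite (_ : (fun _ => _) = (fun x =>
    \sum_(k <oo | k \in xpredT) (digit_term (b ^~ x) k)%:E)%E)//.
apply: (ge0_emeasurable_sum (P := xpredT)) => [k x _ _|k _]; first exact: digit_term_ge0.
by apply/measurable_EFinP; exact: measurable_fun_ifT.
Qed.

End digits.

(** The range of [phi] is measurable, being the set where phi(psi y) = y, and the image of a
    measurable set is its [psi]-preimage cut down to that range. The measure on the line is the law
    of [phi]. *)
Lemma Lebesgue_space_retract d (T : measurableType d) (R : realType)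
    (mu : probability T R) (phi : T -> R) (psi : R -> T) :
  measurable_fun [set: T] phi -> measurable_fun [set: R] psi ->
  cancel phi psi -> Lebesgue_space mu.
Proof.
move=> mphi mpsi phiK; split; first exact: sigma_finiteT.
pose phi_mfun := isMeasurableFun.Build _ _ T (measurableTypeR R) phi mphi.
pose phiM : {mfun T >-> measurableTypeR R} := HB.pack phi phi_mfun.
pose l : probability (measurableTypeR R) R := distribution mu phiM.
have imE (B : set T) : phi @` B = psi @^-1` B `&` [set y | phi (psi y) == y].
  apply/seteqP; split => [_ [x Bx <-]|y [By /eqP <-]]; last by exists (psi y).
  by rewrite /= phiK.
have mim (B : set T) : measurable B -> measurable (phi @` B).
  move=> mB; rewrite imE; apply: measurableI; first exact: (measurable_preimage mpsi).
  rewrite (_ : [set y | _] = (fun y => phi (psi y) == y) @^-1` [set true]).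
    apply: measurable_preimage => //; apply: measurable_fun_eqr => //.
    exact: (measurableT_comp mphi mpsi).
  by apply/seteqP; split.
exists l, phi, setT, (phi @` setT); split.
- by rewrite setCT measure0.
- split; first exact: mim.
  rewrite -[LHS]/(mu (phi @^-1` _)) (_ : _ @^-1` _ = set0) ?measure0//.
  by apply/seteqP; split => // x /= []; exists x.
- split => [x _|x y _ _ /(congr1 psi)|//]; last by rewrite !phiK.
  by exists x.
- by split => // B mB _; exact: mim.
- by move=> B mB; rewrite setTI.
Qed.

Section RZ_Lebesgue.
Context (R : realType).

(** Bits are indexed by codes of pairs of a coordinate and a rational; together they record the
    lower cut of every coordinate. *)
Definition rat_bit (k : nat) (x : RZ R) : bool :=
  if unpickle k is Some (n, q) then ratr (q : rat) < x (n : int) else false.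

Definition RZ_code (x : RZ R) : R := digit_value R (fun k => rat_bit k x).

(** A coordinate is the supremum of the rationals below it; [-oo], neutral for suprema, stands for
    bits that give no lower bound on coordinate [n]. *)
Definition decode_term (n : int) (k : nat) (y : R) : \bar R :=
  if unpickle k is Some (n', q) then
    if n' == n then
      if 4^-1 <= digit_residue k y then (ratr (q : rat))%:E else -oo%E
    else -oo%E
  else -oo%E.

Definition RZ_decode (y : R) : RZ R :=
  fun n => fine (esups (fun k => decode_term n k y) 0%N).

Lemma measurable_RZ_code : measurable_fun [set: RZ R] RZ_code.
Proof.
apply: measurable_digit_value => k; rewrite /rat_bit.
case: unpickle => [[n q]|] //; apply: measurable_fun_ltr => //.
exact: measurable_RZ_coord.
Qed.

Lemma measurable_RZ_decode : measurable_fun [set: R] RZ_decode.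
Proof.
apply: measurable_fun_RZ => n; apply: (measurableT_comp (fine_measurable measurableT)).
apply: measurable_fun_esups => k; rewrite /decode_term.
case: unpickle => [[n' q]|] //; case: (n' == n) => //.
apply: measurable_fun_ifT => //; apply: measurable_fun_ler => //.
exact: measurable_digit_residue.
Qed.

Lemma RZ_codeK : cancel RZ_code RZ_decode.
Proof.
move=> x; apply/funext => n; rewrite /RZ_decode.
suff -> : esups (fun k => decode_term n k (RZ_code x)) 0%N = (x n)%:E by [].
apply/eqP; rewrite eq_le; apply/andP; split.
  apply: ge_ereal_sup => _ [k _ <-]; rewrite /decode_term digit_value_nth /rat_bit.
  case: unpickle => [[n' q]|]; last exact: leNye.
  case: eqP => [->|_]; last exact: leNye.
  by case: ifP => [qx|_]; [rewrite lee_fin ltW|exact: leNye].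
apply/lee_addgt0Pr => e e0.
have xe : x n - e < x n by rewrite gtrBl.
have [q] := rat_in_itvoo xe; rewrite in_itv/= => /andP[xq qx].
apply: (@le_trans _ _ ((ratr q)%:E + e%:E)%E).
  by rewrite -EFinD lee_fin -lerBlDr ltW.
rewrite leeD2r//; apply: ereal_sup_ubound; exists (pickle (n, q)) => //.
by rewrite /decode_term digit_value_nth /rat_bit pickleK eqxx qx.
Qed.

Lemma RZ_Lebesgue_space (mu : probability (RZ R) R) : Lebesgue_space mu.
Proof.
exact: Lebesgue_space_retract measurable_RZ_code measurable_RZ_decode RZ_codeK.
Qed.

End RZ_Lebesgue.

(** * Existence of a gauge for a nonzero homogeneous shift-invariant [Q] *)

Section gauge_existence.
Context (R : realType) (alpha : R) (Q : {measure set (RZ R) -> \bar R}).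
Hypothesis alpha_gt0 : 0 < alpha.
Hypothesis Qshift : forall B : set (RZ R), measurable B ->
  Q (@RZ_shift R @^-1` B) = Q B.
Hypothesis Qscale : forall t : R, 0 < t -> forall B : set (RZ R), measurable B ->
  Q (@RZ_scale R t @^-1` B) = ((t `^ alpha)%:E * Q B)%E.
Hypothesis Q0 : Q [set (fun=> 0) : RZ R] = 0%E.
Hypothesis Qint : (\int[Q]_x (Num.min ((x : RZ R) 0 ^+ 2) 1)%:E < +oo)%E.
Hypothesis QT : Q [set: RZ R] != 0%E.

Definition weight (m : nat) : R := (2 ^+ m)^-1 `^ alpha^-1.

(** Grouping the indices m and -m turns the supremum over the integers into one over a sequence. It
    is extended-valued because finiteness holds only [Q]-almost everywhere. *)
Definition esup_gauge (x : RZ R) : \bar R :=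
  esups (fun m : nat => (weight m * Num.max `|x m%:Z| `|x (- m%:Z)|)%:E) 0.

Lemma weight_gt0 m : 0 < weight m.
Proof. by rewrite powR_gt0// invr_gt0 exprn_gt0. Qed.

Lemma weight_powR m : weight m `^ alpha = (2 ^+ m)^-1.
Proof. by rewrite -powRrM mulVf ?gt_eqF// powRr1// invr_ge0 exprn_ge0. Qed.

Lemma weightS m : weight m = 2 `^ alpha^-1 * weight m.+1.
Proof.
by rewrite -powRM ?invr_ge0 ?exprn_ge0// exprS invfM mulrA mulfV// mul1r.
Qed.

Lemma weight_le m n : (n <= m.+1)%N -> weight m <= 2 `^ alpha^-1 * weight n.
Proof.
move=> nm; rewrite weightS ler_pM2l ?powR_gt0//.
apply: ge0_ler_powR; rewrite ?nnegrE ?invr_ge0 ?exprn_ge0 ?(ltW alpha_gt0)//.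
by rewrite lef_pV2 ?posrE ?exprn_gt0// ler_eXn2l ?ltr1n.
Qed.

Lemma esup_gauge_ub x (n : int) : ((weight `|n|%N * `|x n|)%:E <= esup_gauge x)%E.
Proof.
apply: le_trans (ereal_sup_ubound _); last by exists `|n|%N.
rewrite lee_fin ler_pM2l ?weight_gt0// le_max.
by case: n => n /=; rewrite lexx ?orbT.
Qed.

Lemma esup_gauge_le x (y : \bar R) :
  (forall n : int, (weight `|n|%N * `|x n|)%:E <= y)%E -> (esup_gauge x <= y)%E.
Proof.
move=> xy; apply: ge_ereal_sup => _ [m _ <-]; rewrite maxEle.
case: ifP => _; last exact: (xy m%:Z).
by have := xy (- m%:Z); rewrite abszN.
Qed.

Lemma esup_gauge_ge0 x : (0 <= esup_gauge x)%E.
Proof.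
apply: le_trans (esup_gauge_ub x 0); rewrite lee_fin mulr_ge0//.
exact/ltW/weight_gt0.
Qed.

Lemma esup_gauge_le0 x : (esup_gauge x <= 0)%E -> x = (fun=> 0).
Proof.
move=> x0; apply/funext => n; apply/eqP.
rewrite -normr_le0 -(pmulr_rle0 _ (weight_gt0 `|n|)).
by rewrite -lee_fin (le_trans (esup_gauge_ub x n)).
Qed.

Lemma esup_gaugeZ t x : 0 < t -> esup_gauge (RZ_scale t x) = (t%:E * esup_gauge x)%E.
Proof.
have le a y : 0 < a -> (esup_gauge (RZ_scale a y) <= a%:E * esup_gauge y)%E.
  move=> a0; apply: esup_gauge_le => n.
  rewrite /RZ_scale normrM gtr0_norm// mulrCA EFinM lee_pmul2l//.
  exact: esup_gauge_ub.
move=> t0; apply/eqP; rewrite eq_le le//= -lee_pdivlMl//.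
apply: le_trans (le _ _ _); rewrite ?invr_gt0//.
by rewrite RZ_scaleA mulVf ?gt_eqF// RZ_scale1.
Qed.

(** As |h n| <= |n| + 1, passing from n to h n lowers the weight by a factor of at most
    2^(1/alpha). *)
Lemma esup_gauge_shift_le (g : RZ R -> RZ R) (h : int -> int) x :
  (forall n, g x n = x (h n)) -> (forall n, `|h n| <= `|n|.+1)%N ->
  (esup_gauge (g x) <= (2 `^ alpha^-1)%:E * esup_gauge x)%E.
Proof.
move=> gh hn; apply: esup_gauge_le => n; rewrite gh.
apply: (@le_trans _ _ ((2 `^ alpha^-1)%:E * (weight `|h n|%N * `|x (h n)|)%:E)%E).
  by rewrite -EFinM lee_fin mulrA ler_wpM2r// weight_le.
by rewrite lee_pmul2l ?lte_fin ?powR_gt0// esup_gauge_ub.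
Qed.

Lemma fine_gt0E (y : \bar R) : (0 < fine y) = (0 < y < +oo)%E.
Proof. by case: y => [r| |]//=; rewrite ?ltxx ?lte_fin ?ltry ?andbT. Qed.

(** As [fine] sends [+oo] to 0, positivity of [fine y] means 0 < y < +oo; a two-sided comparison
    transfers both bounds. *)
Lemma fine_gt0_scale (a : R) (y z : \bar R) : 0 < a ->
  (y <= a%:E * z)%E -> (z <= a%:E * y)%E -> (0 < fine y) = (0 < fine z).
Proof.
move=> a0; suff imp u v : (u <= a%:E * v)%E -> (v <= a%:E * u)%E ->
    0 < fine u -> 0 < fine v.
  by move=> yz zy; apply/idP/idP; exact: imp.
rewrite !fine_gt0E => uv vu /andP[u0 uoo]; apply/andP; split.
  rewrite ltNge; apply: contraTN (lt_le_trans u0 uv) => v0.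
  by rewrite -leNgt mule_ge0_le0// lee_fin ltW.
by apply: le_lt_trans vu _; rewrite lte_mul_pinfty// lee_fin ltW.
Qed.

Lemma esup_gauge_shift x :
  (0 < fine (esup_gauge (RZ_shift x))) = (0 < fine (esup_gauge x)).
Proof.
apply: (@fine_gt0_scale (2 `^ alpha^-1)); first by rewrite powR_gt0.
  apply: (@esup_gauge_shift_le (@RZ_shift R) (fun n => n + 1)) => // n.
  lia.
rewrite -{1}(RZ_shiftK x).
apply: (@esup_gauge_shift_le (@RZ_unshift R) (fun n => n - 1)) => // n.
lia.
Qed.

Lemma measurable_esup_gauge : measurable_fun [set: RZ R] esup_gauge.
Proof.
apply: measurable_fun_esups => m; apply/measurable_EFinP.
apply: measurable_funM => //.
by apply: measurable_maxr; apply: measurableT_comp => //; exact: measurable_RZ_coord.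
Qed.

Lemma measurable_esup_gauge_gt (a : \bar R) : measurable [set x | (a < esup_gauge x)%E].
Proof.
by have := emeasurable_fun_o_infty measurableT measurable_esup_gauge a; rewrite setTI.
Qed.

Let measurable_coord_gt n a : measurable [set x : RZ R | a < `|x n|].
Proof.
rewrite (_ : [set x | _] = (fun x : RZ R => a < `|x n|) @^-1` [set true]).
  apply: measurable_preimage => //; apply: measurable_fun_ltr => //.
  by apply: measurableT_comp => //; exact: measurable_RZ_coord.
by apply/seteqP; split.
Qed.

Let q : \bar R := Q [set x : RZ R | 1 < `|x 0|].

Lemma Q_coord_gt1 (n : int) : Q [set x : RZ R | 1 < `|x n|] = q.
Proof.
have S n' : Q [set x : RZ R | 1 < `|x (n' + 1)|] = Q [set x : RZ R | 1 < `|x n'|].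
  by rewrite -(Qshift (measurable_coord_gt n' 1)).
case: n => n; last rewrite NegzE.
  by elim: n => // n <-; rewrite -[RHS]S -PoszD addn1.
elim: n => [|n <-]; first by rewrite -[LHS]S.
by rewrite -[LHS]S -[n.+2]addn1 PoszD opprD subrK.
Qed.

Lemma q_lty : (q < +oo)%E.
Proof.
apply: le_lt_trans Qint.
have mA := measurable_coord_gt 0 1; pose A := [set x : RZ R | 1 < `|x 0|].
apply: (@le_trans _ _ (\int[Q]_(x in A) (1%:E))%E).
  by rewrite integral_cst// mul1e.
have mmin : measurable_fun [set: RZ R] (fun x : RZ R => (Num.min (x 0 ^+ 2) 1)%:E).
  apply/measurable_EFinP; apply: measurable_minr => //.
  by apply: measurable_funX; exact: measurable_RZ_coord.
apply: (@le_trans _ _ (\int[Q]_(x in A)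
    (Num.min (x 0 ^+ 2) 1)%:E)%E).
  apply: ge0_le_integral => //.
  - exact: measurable_funTS.
  - move=> x /= x1; rewrite lee_fin le_min lexx andbT.
    by rewrite -real_normK ?num_real// expr_ge1// ltW.
apply: ge0_subset_integral => // x _.
by rewrite lee_fin le_min sqr_ge0 ler01.
Qed.

Lemma Q_esup_gauge_gt1_lty : (Q [set x | (1 < esup_gauge x)%E] < +oo)%E.
Proof.
pose E m : set (RZ R) := @RZ_scale R (weight m) @^-1`
  ([set x : RZ R | (1 < `|x m%:Z|)%R] `|` [set x : RZ R | (1 < `|x (- m%:Z)|)%R]).
have mE m : measurable (E m).
  apply: measurable_preimage; last exact: measurableU.
  by apply: (measurable_RZ_scale (a := cst (weight m)) (f := id)) => //; exact: measurable_id.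
(* One factor 2 counts the coordinates m and -m, the other turns 2^(-m) into the form e / 2^(m+1)
   expected by [epsilon_trick0]. *)
have QE m : (Q (E m) <= (4 * fine q / (2 ^ m.+1)%:R)%:E)%E.
  rewrite Qscale ?weight_gt0//; last exact: measurableU.
  rewrite weight_powR.
  apply: (@le_trans _ _ (((2 ^+ m)^-1)%:E * (q + q))%E).
    rewrite lee_pmul2l ?lte_fin ?invr_gt0 ?exprn_gt0//.
    apply: (le_trans (measureU2 Q (measurable_coord_gt m%:Z 1)
      (measurable_coord_gt (- m%:Z) 1))).
    by apply: leeD; [rewrite -(Q_coord_gt1 m%:Z)|rewrite -(Q_coord_gt1 (- m%:Z))].
  have qE : q = (fine q)%:E by rewrite fineK// ge0_fin_numE ?q_lty// measure_ge0.
  rewrite qE -EFinD -EFinM lee_fin natrX exprS invfM; lra.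
have : (Q (\bigcup_m E m) <= (4 * fine q)%:E)%E.
  have sub : (Q (\bigcup_m E m) <= \sum_(m <oo) Q (E m))%E.
    by apply: measure_sigma_subadditive => //; exact: bigcupT_measurable.
  apply: le_trans sub _.
  apply: le_trans (epsilon_trick0 xpredT _).
    by apply: lee_nneseries => // k _; exact: QE.
  by rewrite mulr_ge0// fine_ge0// measure_ge0.
move/le_lt_trans => /(_ +oo%E (ltry _)); apply: le_lt_trans.
apply: le_measure; rewrite ?inE.
- exact: measurable_esup_gauge_gt.
- exact: bigcupT_measurable.
move=> x /= /ereal_sup_gt[_ [m _ <-]]; rewrite lte_fin => xm.
exists m => //; rewrite /E/= /RZ_scale !normrM !(gtr0_norm (weight_gt0 m)).
by move: xm; rewrite maxEle; case: ifP => _ ?; [right|left].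
Qed.

Let N0 (x : RZ R) : R := fine (esup_gauge x).

Let measurable_N0 : measurable_fun [set: RZ R] N0.
Proof. exact: measurableT_comp (fine_measurable measurableT) measurable_esup_gauge. Qed.

Let N0Z t x : 0 < t -> N0 (RZ_scale t x) = t * N0 x.
Proof.
move=> t0; rewrite /N0 esup_gaugeZ//.
case: (esup_gauge x) => [r| |]//=; first by rewrite mulr0 gt0_muley ?lte_fin.
by rewrite mulr0 gt0_muleNy ?lte_fin.
Qed.

Let measurable_N0_gt t : measurable [set x | t < N0 x].
Proof.
rewrite (_ : [set x | _] = N0 @^-1` `]t, +oo[).
  exact: (measurable_preimage measurable_N0).
by apply/seteqP; split => x; rewrite /= in_itv/= andbT.
Qed.

(* [Q] has finite mass on this set, which is invariant under scaling *)
Lemma esup_gauge_lty_ae : Q [set x | esup_gauge x = +oo%E] = 0%E.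
Proof.
set A := [set x | _].
have mA : measurable A.
  exact: (measurable_preimage measurable_esup_gauge (emeasurable_set1 _)).
have Afin : (Q A < +oo)%E.
  apply: le_lt_trans Q_esup_gauge_gt1_lty; apply: le_measure; rewrite ?inE//.
    exact: measurable_esup_gauge_gt.
  by move=> x /= ->; rewrite ltry.
have A2 : @RZ_scale R 2 @^-1` A = A.
  apply/seteqP; split => x; rewrite /A /= esup_gaugeZ//; last first.
    by move=> ->; rewrite gt0_muley ?lte_fin.
  by case: (esup_gauge x) => [r| |]//; rewrite gt0_muleNy ?lte_fin.
have := Qscale (ltr0n R 2) mA; rewrite A2.
have -> : Q A = (fine (Q A))%:E by rewrite fineK// ge0_fin_numE.
rewrite -EFinM => -[] /eqP; rewrite -subr_eq0 -[X in X - _]mul1r -mulrBl mulf_eq0.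
case/orP => [|/eqP -> //]; rewrite subr_eq0 eq_sym powR_eq1.
by rewrite (gt_eqF alpha_gt0) (@eqr_nat R 2 1) ltNge ler0n.
Qed.

Let measurable_N0_le0 : measurable [set x | N0 x <= 0].
Proof.
rewrite (_ : [set x | _] = ~` [set x | 0 < N0 x]); first exact: measurableC.
by apply/seteqP; split => x /=; [rewrite leNgt => /negP|move/negP; rewrite -leNgt].
Qed.

(** [fine] gives 0 both at 0 and at [+oo], so the set consists of the zero sequence and the
    sequences of infinite gauge. *)
Lemma N0_null : Q [set x | N0 x <= 0] = 0%E.
Proof.
have m0 : measurable [set (fun=> 0) : RZ R].
  rewrite (_ : [set _] = esup_gauge @^-1` [set 0%E]).
    exact: (measurable_preimage measurable_esup_gauge (emeasurable_set1 _)).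
  apply/seteqP; split => [_ ->|x x0]; last by apply: esup_gauge_le0; rewrite x0.
  apply/eqP; rewrite eq_le esup_gauge_ge0 andbT.
  by apply: esup_gauge_le => n; rewrite normr0 mulr0.
have moo : measurable [set x | esup_gauge x = +oo%E].
  exact: (measurable_preimage measurable_esup_gauge (emeasurable_set1 _)).
have U0 := null_set_setU moo m0 esup_gauge_lty_ae Q0.
apply: (subset_measure0 measurable_N0_le0 (measurableU _ _ moo m0) _ U0) => x /=.
rewrite leNgt /N0 fine_gt0E negb_and -!leNgt leye_eq.
by case/orP => [x0|/eqP]; [right; exact: esup_gauge_le0|left].
Qed.

Let v : \bar R := Q [set x | 1 < N0 x].

Let v_lty : (v < +oo)%E.
Proof.
apply: le_lt_trans Q_esup_gauge_gt1_lty; apply: le_measure; rewrite ?inE//.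
  exact: measurable_esup_gauge_gt.
move=> x /=; rewrite /N0; case: (esup_gauge x) => [r| |]//=.
  by rewrite ltr10.
by rewrite ltr10.
Qed.

Let N0_gtE t : 0 < t -> Q [set x | t < N0 x] = ((t^-1 `^ alpha)%:E * v)%E.
Proof.
move=> t0; rewrite -Qscale ?invr_gt0//; congr (Q _).
by apply/seteqP; split => x /=; rewrite N0Z ?invr_gt0// ltr_pdivlMl// mulr1.
Qed.

(** If {N0 > 1} were null, so would be every {N0 > t} by scaling; those with t = 1/(k+1) cover all
    but a null set, and [Q] would vanish. *)
Let v_gt0 : (0 < v)%E.
Proof.
rewrite lt0e measure_ge0 andbT; apply: contra QT => /eqP v0.
have pos0 : Q (\bigcup_k [set x | k.+1%:R^-1 < N0 x]) = 0%E.
  apply/eqP; rewrite -measure_le0.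
  have sub : (Q (\bigcup_k [set x | k.+1%:R^-1 < N0 x]%R) <=
      \sum_(k <oo) Q [set x | k.+1%:R^-1 < N0 x]%R)%E.
    by apply: measure_sigma_subadditive => //; exact: bigcupT_measurable.
  apply: le_trans sub _; rewrite eseries0// => k _ _.
  by rewrite N0_gtE ?invr_gt0// v0 mule0.
have mpos : measurable (\bigcup_k [set x | k.+1%:R^-1 < N0 x]).
  exact: bigcupT_measurable.
have U0 := null_set_setU measurable_N0_le0 mpos N0_null pos0.
apply/eqP; apply: (subset_measure0 measurableT
  (measurableU _ _ measurable_N0_le0 mpos) _ U0) => x _.
have [x0|x0] := leP (N0 x) 0; [by left|right].
by have [k] := ltr_add_invr x0; rewrite add0r => kx; exists k.
Qed.

Lemma gauge_exists : inhabited (gauge alpha Q).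
Proof.
have [r vr r0] : exists2 r : R, v = r%:E & 0 < r.
  exists (fine v); last by rewrite fine_gt0// v_gt0.
  by rewrite fineK// ge0_fin_numE// measure_ge0.
(* Chosen so that Q(k N0 > 1) = k^alpha r = 1/alpha. *)
pose k := (alpha * r)^-1 `^ alpha^-1.
have k0 : 0 < k by rewrite powR_gt0// invr_gt0 mulr_gt0.
(* The last argument k^-1 bounds |x_0| by the gauge, since coordinate 0 has weight 1. *)
constructor; apply: (@Gauge _ _ _ (fun x => k * N0 x) _ _ _ _ _ _ _ _ _ k^-1) => //.
- exact: measurable_funM.
- by move=> x; rewrite mulr_ge0 ?(ltW k0)// fine_ge0// esup_gauge_ge0.
- by move=> t x t0; rewrite N0Z// mulrCA.
- by move=> x; rewrite !pmulr_rgt0// esup_gauge_shift.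
- rewrite -[RHS]N0_null; congr (Q _).
  by apply/seteqP; split => x /=; rewrite pmulr_rle0.
- transitivity (Q [set x | k^-1 < N0 x]).
    by congr (Q _); apply/seteqP; split => x /=; rewrite -ltr_pdivrMl// mulr1.
  rewrite N0_gtE ?invr_gt0// invrK -powRrM mulVf ?gt_eqF// powRr1; last first.
    by rewrite invr_ge0 mulr_ge0// ltW.
  by rewrite vr -EFinM invfM -mulrA mulVf ?mulr1// gt_eqF.
- move=> x; rewrite pmulr_rgt0// mulrA mulVf ?gt_eqF// mul1r /N0 fine_gt0E.
  move=> /andP[x0 xoo]; rewrite -lee_fin fineK ?ge0_fin_numE ?(ltW x0)//.
  apply: le_trans (esup_gauge_ub x 0).
  by rewrite lee_fin /weight expr0 invr1 powR1 mul1r.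
Qed.

End gauge_existence.

Unset Implicit Arguments.

Theorem theorem7 (R : realType) (alpha : R) (alpha_gt0 : 0 < alpha)
    (alpha_lt2 : alpha < 2)
    (d0 : measure_display) (Om0 : measurableType d0) (P : probability Om0 R)
    (X : {RV P >-> RZ R}) (Q : {measure set (RZ R) -> \bar R})
    (XQ : stable_stationary alpha X Q) :
  exists (d : measure_display) (Omega : measurableType d)
    (mu : probability Omega R) (T : nonsingular_automorphism mu)
    (f : Omega -> R),
  [/\ Lebesgue_space mu,
      f \in Lfun mu alpha%:E
    & system_iso (mu \x stable_radial alpha)%E (Ttilde alpha T)
        Q (@RZ_shift R) (Theta alpha T f)].
Proof.
have [[_ _ [_ Qshift Q0 Qint _]] QT Qscale] := XQ.
have [N] := gauge_exists alpha_gt0 Qshift Qscale Q0 Qint QT.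
exists _, (RZ R), (gauge_prob N), (gauge_automorphism N), (fun w : RZ R => w 0).
split.
- exact: RZ_Lebesgue_space.
- exact: coord0_Lfun.
- exact: Theta_system_iso.
Qed.
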